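(* There is a valid $(m, 1)$ protocol for maximum matching (computing the size of a maximum matching of the graph). Moreover, any protocol for maximum matching requires (annotation length)$\cdot$(verifier working memory) $= \Omega(n^2)$ bits.
   Context: Setting (annotation model): a verifier $\mathcal{V}$ with a private random string and small working memory, and a deterministic helper $\mathcal{H}$, both observe a data stream $\mathcal{A}$ of $m$ edges of an undirected (multi)graph $G=(V,E)$ on $n$ nodes; after the stream ends, $\mathcal{H}$ sends an annotation $h(\mathcal{A})$, which $\mathcal{V}$ also reads as a stream. $\mathcal{V}$ may output $\perp$ if unconvinced. A protocol is valid if (1) there is at least one helper whose annotation makes $\mathcal{V}$ output the correct answer with probability 1 on every stream, and (2) for every helper and every stream, either that helper's annotation is valid for the stream or $\mathcal{V}$ outputs something other than $\perp$ with probability at most $1/3$. An $(h,v)$ protocol is a valid protocol whose annotation length (help cost) is $O(h+1)$ and whose verifier working memory (verification cost) is $O(v+1)$, measured in machine words of $\Theta(\log m)$ bits; lower bounds are in bits.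
   Formalization: The cost bounds of the (m,1) protocol are stated for log n = O(log m), so that a node name fits in O(1) words; the lower bound is stated for streams with m = Ω(n²), with annotation length read as max(1, length), since a protocol without annotation would make the product zero. *)

(* Defs.v *)
From mathcomp Require Import all_boot all_order all_algebra.

Set Implicit Arguments.
Unset Strict Implicit.
Unset Printing Implicit Defensive.

Import Order.TTheory GRing.Theory Num.Theory.

Definition edge (n : nat) : finType := {e : {set 'I_n} | #|e| == 2}.

(* Tokens may repeat: a stream is a loopless multigraph with m edges. *)
Definition stream (n m : nat) : finType := m.-tuple (edge n).

Definition edge_set (n m : nat) (A : stream n m) : {set {set 'I_n}} :=
  [set val e | e in A].

(* Parallel edges share their endpoints, so a matching uses at most one of
   them and can be given as a set of node pairs. *)
Definition is_matching (n m : nat) (A : stream n m) (M : {set {set 'I_n}}) : bool :=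
  (M \subset edge_set A) && trivIset M.

Definition max_matching_size (n m : nat) (A : stream n m) : nat :=
  \max_(M : {set {set 'I_n}} | is_matching A M) #|M|.

(* The private random string is read-only, can be consulted at every step and
   is not charged to the working memory; the transition functions are
   arbitrary.  [None] is the output "not convinced". *)
Record verifier (n : nat) := Verifier {
  rand_bits : nat;
  memory_bits : nat;
  start : rand_bits.-tuple bool -> memory_bits.-tuple bool;
  read_edge : rand_bits.-tuple bool -> memory_bits.-tuple bool ->
              edge n -> memory_bits.-tuple bool;
  read_annotation : rand_bits.-tuple bool -> memory_bits.-tuple bool ->
                    bool -> memory_bits.-tuple bool;
  output : rand_bits.-tuple bool -> memory_bits.-tuple bool -> option nat
}.

Definition annotation := seq bool.

Definition helper (n m : nat) := stream n m -> annotation.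

Definition out (n m : nat) (V : verifier n) (A : stream n m)
    (R : (rand_bits V).-tuple bool) (a : annotation) : option nat :=
  output R (foldl (read_annotation R) (foldl (read_edge R) (start R) A) a).

Definition prob (r : nat) (P : pred (r.-tuple bool)) : rat :=
  (#|P|%:R / #|{: r.-tuple bool}|%:R)%R.

Definition valid_annotation (n m : nat) (f : stream n m -> nat) (V : verifier n)
    (A : stream n m) (a : annotation) : Prop :=
  prob (fun R : (rand_bits V).-tuple bool => out A R a == Some (f A)) = 1%R.

Definition complete (n m : nat) (f : stream n m -> nat) (V : verifier n)
    (H : helper n m) : Prop :=
  forall A : stream n m, valid_annotation f V A (H A).

Definition sound (n m : nat) (f : stream n m -> nat) (V : verifier n) : Prop :=
  forall (H : helper n m) (A : stream n m),
    valid_annotation f V A (H A) \/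
    (prob (fun R : (rand_bits V).-tuple bool => out A R (H A) != None)
       <= 1 / 3%:R)%R.

Record protocol (n m : nat) := Protocol {
  the_verifier : verifier n;
  the_helper : helper n m
}.

Definition valid_protocol (n m : nat) (f : stream n m -> nat)
    (P : protocol n m) : Prop :=
  complete f (the_verifier P) (the_helper P) /\ sound f (the_verifier P).

Definition help_cost (n m : nat) (P : protocol n m) : nat :=
  \max_(A : stream n m) size (the_helper P A).

Definition verification_cost (n m : nat) (P : protocol n m) : nat :=
  memory_bits (the_verifier P).

(* The bit length of k: with k = m, the size of a machine word. *)
Definition bit_length (k : nat) : nat := (trunc_log 2 k).+1.

(* Machine words of Theta(log m) bits presuppose that a node name fits in O(1)
   words, i.e. log n = O(log m); the constant K makes this explicit. *)
Definition hv_protocol (f : forall n m : nat, stream n m -> nat)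
    (h v : nat -> nat -> nat) (P : forall n m : nat, protocol n m) : Prop :=
  (forall n m : nat, valid_protocol (@f n m) (P n m)) /\
  forall K : nat, exists C : nat, forall n m : nat,
    bit_length n <= K * bit_length m ->
    help_cost (P n m) <= C * ((h n m).+1 * bit_length m) /\
    verification_cost (P n m) <= C * ((v n m).+1 * bit_length m).

(* Main.v *)
Require Import Defs.
From mathcomp Require Import all_boot all_order all_algebra.
From mathcomp Require Import zify.
Import Order.TTheory GRing.Theory Num.Theory.
Set Implicit Arguments.
Unset Strict Implicit.
Unset Printing Implicit Defensive.

(** Upper bound.  By Edmonds' form of the Tutte-Berge formula, the size of a
maximum matching is the least value of |S| + sum_c floor(|B_c| / 2) over vertex
sets S and B_c such that every edge meets S or lies inside some B_c.  The helper
lists the edges in any order, marking those of a maximum matching and naming for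
each edge the vertex of S or the set B_c that covers it; then he lists, sorted by
label, all the pairs (label, vertex) that these choices give rise to.  Sorting lets
the verifier count the vertices of each label on the fly, and the two equalities
of multisets (edges against the stream, pairs against the sorted list) are checked
by a random fingerprint, whose random hash function is free of charge.  The B_c
need not be disjoint, so the labelling needs no further verification.

Lower bound.  Alice streams a bipartite graph coding s^2 bits; Bob hangs pendant
edges on all left nodes but i and all right nodes but j, so that the size of a
maximum matching reveals bit (i, j).  Running O(help cost) independent copies of
the verifier makes every wrong annotation fail except with tiny probability, so Bob
can try all annotations: this recovers almost all bits from
O(help cost * memory) bits, and a counting argument concludes. *)

(** * Coding finite types in one another, and counting form of probabilities *)

Definition embed (U V : finType) (leUV : #|U| <= #|V|) (u : U) : V :=
  enum_val (widen_ord leUV (enum_rank u)).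

Lemma embed_inj (U V : finType) (leUV : #|U| <= #|V|) : injective (embed leUV).
Proof.
move=> u v /enum_val_inj /(congr1 val) /= /ord_inj; exact: enum_rank_inj.
Qed.

Definition unembed (U V : finType) (leUV : #|U| <= #|V|) (v : V) : option U :=
  [pick u | embed leUV u == v].

Lemma embedK (U V : finType) (leUV : #|U| <= #|V|) : pcancel (embed leUV) (unembed leUV).
Proof.
move=> u; rewrite /unembed; case: pickP => [v /eqP/embed_inj->//|/(_ u)].
by rewrite eqxx.
Qed.

(** Between types of equal size the embedding is a bijection, so transporting an event along it
    keeps the number of favourable outcomes. *)
Lemma card_embed_preim (U V : finType) (leUV : #|U| <= #|V|) (Q : pred V) :
  #|U| = #|V| -> #|[pred u | Q (embed leUV u)]| = #|Q|.
Proof.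
move=> eqUV; have bij := inj_card_bij (@embed_inj _ _ leUV) (eq_leq (esym eqUV)).
rewrite -(card_image (@embed_inj _ _ leUV)); apply: eq_card => v.
have [g _ gK] := bij; apply/imageP/idP => [[u + ->] //|Qv].
by exists (g v); rewrite ?inE gK.
Qed.

Lemma card_rand r : 0 < #|{: r.-tuple bool}|.
Proof. by rewrite card_tuple card_bool expn_gt0. Qed.

Lemma prob_eq1 r (Q : pred (r.-tuple bool)) : prob Q = 1%R <-> forall R, Q R.
Proof.
have c0 : (#|{: r.-tuple bool}|%:R != 0 :> rat)%R by rewrite pnatr_eq0 -lt0n card_rand.
rewrite /prob; split=> [/(congr1 (fun x => x * #|{: r.-tuple bool}|%:R)%R)|H]; last first.
  by rewrite (@eq_card _ Q predT) ?divff // => R; rewrite !inE /in_mem /= H.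
rewrite mulfVK // mul1r => /eqP; rewrite eqr_nat => /eqP cQ R.
have /subset_cardP/(_ (subset_predT Q)) := cQ.
by move/(_ R); rewrite !inE.
Qed.

Lemma prob_le3 r (Q : pred (r.-tuple bool)) :
  (prob Q <= 1 / 3%:R)%R = (3 * #|Q| <= #|{: r.-tuple bool}|).
Proof.
have c0 : (0 < #|{: r.-tuple bool}|%:R :> rat)%R by rewrite ltr0n card_rand.
by rewrite /prob ler_pdivrMr // mulrAC ler_pdivlMr // mul1r -natrM ler_nat mulnC.
Qed.

Lemma card_bseq_bool k : #|{: k.-bseq bool}| < 2 ^ k.+1.
Proof.
rewrite card_bseq card_bool; elim: k => [|k IH]; first by rewrite big_ord1.
by rewrite big_ord_recr /= [2 ^ k.+2]expnS mul2n -addnn -addSn leq_add2r.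
Qed.

(** * Odd set covers *)

Section Duality.
Variable T : finType.
Implicit Types (E M N : {set {set T}}) (e f : {set T}) (S : {set T}).

Definition graph E := [forall e in E, #|e| == 2].
Definition matching E M := (M \subset E) && trivIset M.
Definition nu E := \max_(M | matching E M) #|M|.
Definition maximum E M := matching E M && (#|M| == nu E).

Lemma graphP E e : graph E -> e \in E -> #|e| = 2.
Proof. by move=> /forall_inP gE /gE /eqP. Qed.

Lemma graph_sub E E' : E' \subset E -> graph E -> graph E'.
Proof. by move=> sE gE; apply/forall_inP=> e /(subsetP sE) /(graphP gE) ->. Qed.

Lemma matching0 E : matching E set0.
Proof.
by rewrite /matching sub0set; apply/trivIsetP=> A B; rewrite inE.
Qed.

Lemma maximum_exists E : exists M, maximum E M.
Proof.
have [|M mM eqM] := eq_bigmax_cond (fun M => #|M|) (A := matching E).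
  by apply/card_gt0P; exists set0; apply: matching0.
by exists M; rewrite /maximum /nu eqM eqxx andbT.
Qed.

Lemma leq_nu E M : matching E M -> #|M| <= nu E.
Proof. by move=> mM; rewrite /nu (leq_bigmax_cond (P := matching E)). Qed.

Lemma card_cover_matching E M : graph E -> matching E M -> #|cover M| = #|M| * 2.
Proof.
move=> gE /andP[sME /eqP <-]; rewrite -sum_nat_const; apply: eq_bigr => e eM.
by rewrite (graphP gE) // (subsetP sME).
Qed.

Lemma matching_uniq E M e f x :
  matching E M -> e \in M -> f \in M -> x \in e -> x \in f -> e = f.
Proof.
move=> /andP[_ tM] eM fM xe xf.
by rewrite -(def_pblock tM eM xe) (def_pblock tM fM xf).
Qed.

Lemma matching_add E M e : graph E -> matching E M -> e \in E ->
  [disjoint e & cover M] -> matching E (e |: M) /\ #|e |: M| = #|M|.+1.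
Proof.
move=> gE /andP[sM tM] eE dis.
have [||tU eM] := @trivIsetU1 _ e M _ tM.
- move=> B BM; apply: disjointWr dis; exact: bigcup_sup.
- by apply/negP=> /(subsetP sM) /(graphP gE); rewrite cards0.
by rewrite cardsU1 eM /matching subUset sub1set eE sM tU.
Qed.

Lemma maximum_meets E M e : graph E -> maximum E M -> e \in E ->
  exists2 y, y \in e & y \in cover M.
Proof.
move=> gE /andP[mM /eqP cM] eE.
case: (boolP [disjoint e & cover M]) => [dis|].
  have [mM' cM'] := matching_add gE mM eE dis.
  by have := leq_nu mM'; rewrite cM' cM ltnn.
by case/pred0Pn=> y /andP[/= ye yM]; exists y.
Qed.

(** As [x] is free and the other end [y] lies in [f], only [f] blocks [e]; the exchange therefore
    keeps the size, and it newly covers at most vertices of [e]. *)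
Lemma matching_swap E N e f x y : graph E -> maximum E N -> e \in E ->
  e = [set x; y] -> x \notin cover N -> f \in N -> y \in f ->
  let N' := e |: (N :\ f) in maximum E N' /\ cover N' \subset e :|: cover N.
Proof.
move=> gE /andP[mN /eqP cN] eE eE2 xN fN yf N'.
have sN : N :\ f \subset N by rewrite subD1set.
have mD : matching E (N :\ f).
  by case/andP: mN => sNE tN; rewrite /matching (subset_trans sN) // (trivIsetS sN).
have dis : [disjoint e & cover (N :\ f)].
  rewrite eE2 disjoints_subset; apply/subsetP=> z; rewrite !inE => /orP[]/eqP->.
    apply/negP=> /bigcupP[g /setD1P[_ gN] xg].
    by case/negP: xN; apply/bigcupP; exists g.
  apply/negP=> /bigcupP[g /setD1P[gf gN] yg].
  by rewrite (matching_uniq mN gN fN yg yf) eqxx in gf.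
have [mN' cN'] := matching_add gE mD eE dis; split.
  by rewrite /maximum mN' cN' -cN (cardsD1 f N) fN add1n eqxx.
rewrite /cover bigcup_setU big_set1 setUS //.
by apply/bigcupsP=> g gN; apply: bigcup_sup; apply: (subsetP sN).
Qed.

(** Gallai's relation. When each vertex is missed by some maximum matching it is an equivalence;
    every edge then lies in one class, and a maximum matching misses at most one vertex of each
    class. *)
Definition linked E x y :=
  [forall M, maximum E M ==> [|| x == y, x \in cover M | y \in cover M]].

Lemma linkedP E x y : reflect
  (forall M, maximum E M -> x != y -> x \notin cover M -> y \in cover M) (linked E x y).
Proof.
apply: (iffP forall_inP) => H M mM.
  by move=> /negPf xy /negPf xM; have := H M mM; rewrite xy xM.
by case: eqVneq => //= xy; case: (boolP (x \in _)) => //= xM; apply: H.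
Qed.

Lemma linkedC E x y : linked E x y = linked E y x.
Proof. by rewrite /linked; apply: eq_forallb => M; rewrite eq_sym [(_ \in _) || _]orbC. Qed.

Lemma linked_edge E e x y : graph E -> e \in E -> x \in e -> y \in e -> linked E x y.
Proof.
move=> gE eE xe ye; apply/linkedP=> M mM xy xM.
have [z ze zM] := maximum_meets gE mM eE.
suff -> : y = z by [].
have ezx : z != x by apply: contraNneq xM => <-.
have /eqP := graphP gE eE; rewrite (cardsD1 x) xe eqSS => /cards1P[w Ew].
have yw : y \in [set w] by rewrite -Ew !inE eq_sym xy.
have zw : z \in [set w] by rewrite -Ew !inE ezx.
by move: yw zw; rewrite !inE => /eqP-> /eqP->.
Qed.

(* Gallai's lemma.  Among the maximum matchings missing t, take the N closest to
   M; a vertex x != t covered by M but not by N can be exchanged into N along its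
   M-edge, which brings N closer to M. *)
Lemma linked_trans E t u v : graph E ->
  (exists2 M, maximum E M & t \notin cover M) ->
  linked E u t -> linked E t v -> linked E u v.
Proof.
move=> gE [N0 mN0 tN0] /linkedP ut /linkedP tv; apply/linkedP=> M mM uv uM.
apply/negPn/negP=> vM.
have [Eut|nut] := eqVneq u t; first by case/negP: vM; apply: tv; rewrite -?Eut.
have [Etv|ntv] := eqVneq t v; first by case/negP: vM; rewrite -Etv; apply: ut; rewrite ?Etv.
pose P N := maximum E N && (t \notin cover N).
have PN0 : P N0 by rewrite /P mN0 tN0.
case: (arg_maxnP (fun N => #|M :&: N|) PN0) => N /andP[mN tN] maxN.
have uN : u \in cover N.
  by apply/negPn/negP=> uN; case/negP: tN; apply: ut.
have vN : v \in cover N by apply: tv.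
have [/andP[mM1 /eqP cM] /andP[mN1 /eqP cN]] := (mM, mN).
have eqc : #|cover M| = #|cover N|.
  by rewrite (card_cover_matching gE mM1) (card_cover_matching gE mN1) cM cN.
have eqd : #|cover M :\: cover N| = #|cover N :\: cover M|.
  by apply/eqP; rewrite -(eqn_add2l #|cover M :&: cover N|) cardsID setIC cardsID eqc.
(* [N] covers [u] and [v], which [M] misses. As both matchings cover equally many vertices, [M]
   alone covers at least two, one of them different from [t]. *)
have ge2 : 1 < #|cover M :\: cover N|.
  rewrite eqd; have <- : #|[set u; v]| = 2 by rewrite cards2 uv.
  apply: subset_leq_card; apply/subsetP=> z; rewrite !inE => /orP[]/eqP->.
    by rewrite uM.
  by rewrite vM.
have /card_gt0P[x] : 0 < #|(cover M :\: cover N) :\ t|.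
  by move: ge2; rewrite (cardsD1 t); case: (_ \in _); rewrite ?add0n // => /ltnW.
rewrite !inE => /and3P[xt xN xM].
have eM := pblock_mem xM; set e := pblock M x in eM.
have xe : x \in e by rewrite mem_pblock.
have eE : e \in E by case/andP: mM1 => /subsetP/(_ _ eM).
have [y ye yN] := maximum_meets gE mN eE.
have xy : x != y by apply: contraNneq xN => ->.
have Ee : e = [set x; y].
  apply/esym/eqP; rewrite eqEcard cards2 xy (graphP gE eE) andbT.
  by apply/subsetP=> z; rewrite !inE => /orP[]/eqP->.
have fN := pblock_mem yN; set f := pblock N y in fN.
have yf : y \in f by rewrite mem_pblock.
have fM : f \notin M.
  apply/negP=> fM; case/negP: xN; apply/bigcupP; exists f => //.
  by rewrite -(matching_uniq mM1 eM fM ye yf).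
have eN : e \notin N.
  by apply/negP=> eN; case/negP: xN; apply/bigcupP; exists e.
have [mN' sN'] := matching_swap gE mN eE Ee xN fN yf.
have /maxN : P (e |: (N :\ f)).
  rewrite /P mN'; apply/negP=> /(subsetP sN'); rewrite Ee !inE (negPf tN) orbF.
  by rewrite eq_sym (negPf xt) /= => /eqP ty; rewrite ty yN in tN.
have : e |: (M :&: N) \subset M :&: (e |: (N :\ f)).
  apply/subsetP=> g; rewrite !inE => /orP[/eqP->|/andP[gM gN]]; first by rewrite eM eqxx.
  rewrite gM gN andbT orbC; case: eqVneq => // gf.
  by rewrite gf (negPf fM) in gM.
move/subset_leq_card; rewrite cardsU1 inE (negPf eN) andbF /= => H1 H2.
by have := leq_trans H1 H2; rewrite add1n ltnn.
Qed.

Definition odd_cover E S (B : T -> {set T}) :=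
  forall e, e \in E -> (exists2 u, u \in e & u \in S) \/ (exists c, e \subset B c).

(** The sets are the classes of [linked]. A maximum matching misses at most one vertex of the class
    [B c], and its edges do not leave classes, so at least half of |B_c|, rounded down, of them lie
    inside. *)
Lemma odd_cover_inessential E : graph E ->
  (forall v, exists2 M, maximum E M & v \notin cover M) ->
  exists2 B, odd_cover E set0 B & \sum_c #|B c|./2 <= nu E.
Proof.
move=> gE iE.
have rT : transitive (linked E) by move=> t u v; apply: linked_trans.
have rr x : linked E x x by apply/linkedP=> M _; rewrite eqxx.
(* The picked vertex depends only on the predicate, hence only on the class of [x]. *)
pose canon x := odflt x [pick y | linked E x y].
have cE x y : linked E x y -> canon x = canon y.
  move=> xy; rewrite /canon; have -> : [pick z | linked E x z] = [pick z | linked E y z].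
    apply: eq_pick => z /=; apply/idP/idP; last exact: rT.
    by apply: rT; rewrite linkedC.
  by case: pickP => // /(_ y); rewrite rr.
have rC x : linked E x (canon x).
  by rewrite /canon; case: pickP => //= _; apply: rr.
have cR x y : canon x = canon y -> linked E x y.
  move=> xy; apply: rT (rC x) _; rewrite xy linkedC; exact: rC.
pose B c := [set x | canon x == c].
have eB e : e \in E -> exists c, e \subset B c.
  move=> eE; have /card_gt0P[x xe] : 0 < #|e| by rewrite (graphP gE).
  exists (canon x); apply/subsetP=> y ye; rewrite inE.
  by apply/eqP/cE/(linked_edge gE eE).
exists B; first by move=> e /eB; right.
have [M mM] := maximum_exists E; have /andP[mM1 /eqP <-] := mM.
pose h e := omap canon [pick x in e].
pose Mc c := [set e in M | h e == Some c].
have half c : #|B c|./2 <= #|Mc c|.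
  have sM : Mc c \subset M by apply/subsetP=> e; rewrite inE => /andP[].
  have mMc : matching E (Mc c).
    by case/andP: mM1 => sE tM; rewrite /matching (subset_trans sM) // (trivIsetS sM).
  suff H : #|B c| <= (#|Mc c| * 2).+1.
    by move: H => /half_leq /leq_trans; apply; rewrite muln2 -[_.+1]/(true + _) half_bit_double.
  rewrite -(card_cover_matching gE mMc) -(cardsID (cover M) (B c)) -addn1 leq_add //.
    apply: subset_leq_card; apply/subsetP=> x; rewrite !inE => /andP[/eqP xc xM].
    apply/bigcupP; exists (pblock M x); last by rewrite mem_pblock.
    rewrite inE pblock_mem // /h; case: pickP => [z zx|/(_ x)]; last by rewrite mem_pblock xM.
    have eE : pblock M x \in E by case/andP: mM1 => /subsetP-> //; apply: pblock_mem.
    rewrite /= -xc; apply/eqP; congr Some; apply: cE; apply: (linked_edge gE eE) => //.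
    by rewrite mem_pblock.
  apply/card_le1_eqP=> x y; rewrite !inE => /andP[xM /eqP xc] /andP[yM /eqP yc].
  have [//|xy] := eqVneq y x.
  have /cR/linkedP/(_ M mM xy yM) : canon y = canon x by rewrite xc.
  by rewrite (negPf xM).
apply: (@leq_trans (\sum_c #|Mc c|)); first by apply: leq_sum => c _.
(* Double counting: every edge of [M] is attributed to at most one class. *)
rewrite (eq_bigr (fun c => \sum_(e in M) (h e == Some c))); last first.
  move=> c _; rewrite -sum1_card big_mkcond [RHS]big_mkcond; apply: eq_bigr => e _.
  by rewrite inE; case: (_ \in _); case: (_ == _).
rewrite exchange_big -sum1_card /=; apply: leq_sum => e _.
case: (h e) => [c|]; last by rewrite big1.
by rewrite (bigD1 c) //= eqxx big1 // => c' cc'; case: eqP => // -[E1]; rewrite E1 eqxx in cc'.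
Qed.

(** Induction on the number of edges. If every maximum matching covers some vertex [v], deleting the
    edges at [v] lowers [nu], which pays for putting [v] into [S]; otherwise Gallai's case
    applies. *)
Lemma odd_cover_exists E : graph E ->
  exists S, exists2 B, odd_cover E S B & #|S| + \sum_c #|B c|./2 <= nu E.
Proof.
have [k] := ubnP #|E|; elim: k E => // k IH E; rewrite ltnS => leE gE.
have [/forallP iE|] := boolP [forall v, exists M, maximum E M && (v \notin cover M)].
  have [|B oB leB] := odd_cover_inessential gE.
    by move=> v; have /existsP[M /andP[]] := iE v; exists M.
  by exists set0, B; rewrite ?cards0.
rewrite negb_forall => /existsP[v]; rewrite negb_exists => /forallP vE.
have vM M : maximum E M -> v \in cover M.
  by move=> mM; have := vE M; rewrite mM /= negbK.
pose E' := [set e in E | v \notin e].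
have sE' : E' \subset E by apply/subsetP=> e; rewrite inE => /andP[].
have ltE : #|E'| < #|E|.
  have [M mM] := maximum_exists E; have /bigcupP[e eM ve] := vM M mM.
  apply: proper_card; apply/properP; split=> //; exists e.
    by case/andP: mM => /andP[/subsetP-> //].
  by rewrite inE ve andbF.
(* A matching of [E'] with [nu E] edges would be maximum in [E] and yet miss [v]. *)
have ltnu : nu E' < nu E.
  have [M /andP[/andP[sM tM] /eqP cM]] := maximum_exists E'.
  have mM : matching E M by rewrite /matching (subset_trans sM).
  rewrite -cM ltn_neqAle leq_nu // andbT; apply/negP=> cM'.
  have /bigcupP[e /(subsetP sM)] : v \in cover M by apply: vM; rewrite /maximum mM.
  by rewrite inE => /andP[_ /negPf->].
have [S [B oB leS]] := IH E' (leq_trans ltE leE) (graph_sub sE' gE).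
exists (v |: S), B.
  move=> e eE; have [ve|ve] := boolP (v \in e); first by left; exists v; rewrite ?setU11.
  have eE' : e \in E' by rewrite inE eE.
  have [[u ue uS]|] := oB e eE'; last by right.
  by left; exists u; rewrite ?inE ?uS ?orbT.
apply: leq_trans ltnu; rewrite -add1n (leq_trans _ (leq_add (leqnn 1) leS)) //.
by rewrite addnA leq_add2r cardsU1; case: (_ \notin _).
Qed.

(** Weak duality: disjoint edges meeting [S] use distinct vertices of [S], and those inside [B c]
    use two vertices of it each. The index type is free, so that an empty one gives the bound by a
    vertex cover. *)
Lemma odd_cover_bound (I : finType) E N S (B : I -> {set T}) :
  graph E -> matching E N ->
  (forall e, e \in E -> (exists2 u, u \in e & u \in S) \/ (exists c, e \subset B c)) ->
  #|N| <= #|S| + \sum_c #|B c|./2.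
Proof.
move=> gE mN cE; have /andP[sN tN] := mN.
pose NS := [set e in N | ~~ [disjoint e & S]].
pose Nc c := [set e in N | e \subset B c].
have sub : N \subset NS :|: \bigcup_c Nc c.
  apply/subsetP=> e eN; rewrite !inE eN /=.
  have [[u ue uS]|[c ec]] := cE e (subsetP sN e eN).
    by apply/orP; left; apply/pred0Pn; exists u; rewrite /= ue.
  by apply/orP; right; apply/bigcupP; exists c; rewrite // inE eN.
apply: leq_trans (subset_leq_card sub) _.
apply: leq_trans (leq_card_setU _ _) _; apply: leq_add.
  have : NS \subset [set pblock N u | u in S].
    apply/subsetP=> e; rewrite inE => /andP[eN /pred0Pn[u /andP[/= ue uS]]].
    by apply/imsetP; exists u; rewrite ?(def_pblock tN eN ue).
  by move/subset_leq_card/leq_trans; apply; apply: leq_imset_card.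
apply: (@leq_trans (\sum_c #|Nc c|)).
  elim/big_rec2: _ => [|c n U _ leU]; first by rewrite cards0.
  by apply: leq_trans (leq_card_setU _ _) _; rewrite leq_add2l.
apply: leq_sum => c _.
have sc : Nc c \subset N by apply/subsetP=> e; rewrite inE => /andP[].
have mc : matching E (Nc c) by rewrite /matching (subset_trans sc) // (trivIsetS sc).
rewrite -(half_bit_double #|Nc c| false) add0n half_leq // -muln2.
rewrite -(card_cover_matching gE mc); apply: subset_leq_card.
by apply/bigcupsP=> e; rewrite inE => /andP[].
Qed.

End Duality.

Lemma leq_nu_indexed (T I : finType) (E : {set {set T}}) (h : I -> {set T}) :
  graph E -> (forall i, h i \in E) ->
  (forall i j, i != j -> [disjoint h i & h j]) -> #|I| <= nu E.
Proof.
move=> gE hE dis.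
have h_inj : injective h.
  move=> i j hij; apply/eqP; apply: contraT => /dis; rewrite hij -setI_eq0 setIid.
  by move=> /eqP h0; have := graphP gE (hE j); rewrite h0 cards0.
rewrite -(card_imset predT h_inj); apply: leq_nu; apply/andP; split.
  by apply/subsetP=> _ /imsetP[i _ ->].
apply/trivIsetP=> _ _ /imsetP[i _ ->] /imsetP[j _ ->] hij.
by apply: dis; apply: contraNneq hij => ->.
Qed.

Lemma max_matching_sizeE n m (A : stream n m) : max_matching_size A = nu (edge_set A).
Proof. by []. Qed.

Lemma graph_edge_set n m (A : stream n m) : graph (edge_set A).
Proof. by apply/forall_inP=> _ /imsetP[e _ ->]; apply: (valP e). Qed.

Lemma mem_edge_set n m (A : stream n m) e : (val e \in edge_set A) = (e \in A).
Proof. by rewrite /edge_set mem_imset //; apply: val_inj. Qed.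

(** * The lower bound *)

Lemma leq_expl a b k : a <= b -> a ^ k <= b ^ k.
Proof. by case: k => // k; rewrite leq_exp2r. Qed.

(** * Hamming balls and the size of codes with few decoding errors *)

Section HammingBall.
Variables (I : finType) (L : nat).
Hypothesis cardI : #|I| = 16 * L.
Notation X := {ffun I -> bool}.

Definition hamming (x y : X) := \sum_i (x i != y i).

(* A ball is measured by giving the point x the weight 8^(16 L - hamming x y);
   these weights add up to 9^(16 L). *)
Lemma card_hamming_ball (y : X) : #|[set x | hamming x y <= L]| <= 2 ^ (7 * L).
Proof.
pose wt (x : X) := \prod_i (if x i == y i then 8 else 1).
have wtD x : wt x * 8 ^ hamming x y = 8 ^ (16 * L).
  rewrite -cardI -prod_nat_const expn_sum -big_split /=.
  by apply: eq_bigr => i _; case: (_ == _).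
have sum_wt : \sum_x wt x = 9 ^ (16 * L).
  rewrite -cardI -prod_nat_const.
  rewrite -(bigA_distr_bigA (fun i b => if b == y i then 8 else 1)) /=.
  by apply: eq_bigr => i _; rewrite big_bool; case: (y i).
have H : #|[set x | hamming x y <= L]| * 8 ^ (15 * L) <= 9 ^ (16 * L).
  rewrite -sum_wt -sum_nat_const big_mkcond /=; apply: leq_sum => x _.
  rewrite inE; case: ifP => // le_d.
  have h8 : 0 < 8 ^ hamming x y by rewrite expn_gt0.
  rewrite -(leq_pmul2r h8) wtD -(expnD 8 (15 * L)) leq_exp2l //.
  by rewrite (leq_trans (leq_add (leqnn _) le_d)) // -mulSnr.
have H9 : 9 ^ (16 * L) <= 2 ^ (7 * L) * 8 ^ (15 * L).
  (* That is 6561 against 8192. Raised to the power [4 * L] it yields the exponent [52 * L], and 52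
     = 7 + 3 * 15. *)
  have e4 : 9 ^ 4 <= 2 ^ 13 by [].
  have -> : 9 ^ (16 * L) = (9 ^ 4) ^ (4 * L) by rewrite -expnM mulnA.
  have e8 a : 8 ^ a = 2 ^ (3 * a) by rewrite expnM.
  rewrite e8 -expnD.
  apply: (@leq_trans ((2 ^ 13) ^ (4 * L))); first exact: leq_expl.
  by rewrite -expnM leq_exp2l // !mulnA -mulnDl.
by have := leq_trans H H9; rewrite leq_pmul2r ?expn_gt0.
Qed.

(** By Markov's inequality at least half of all points are decoded with at most [L] errors. Balls
    around the decoded words cover these points, which leaves the exponent 16 - 7 = 9. *)
Lemma code_bound (C : finType) (enc : X -> C) (dec : C -> X) :
  2 * \sum_x hamming x (dec (enc x)) <= L * #|{: X}| ->
  2 ^ (9 * L) <= 2 * #|C|.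
Proof.
move=> le_err.
pose good := [set x | hamming x (dec (enc x)) <= L].
have le_bad : 2 * #|~: good| <= #|{: X}|.
  rewrite -(leq_pmul2l (ltn0Sn L)) mulnCA.
  apply: leq_trans (leq_trans (_ : _ <= 2 * \sum_x hamming x (dec (enc x))) le_err) _.
    rewrite leq_pmul2l // mulnC -sum_nat_const big_mkcond /=; apply: leq_sum => x _.
    by rewrite !inE -ltnNge; case: ifP.
  by rewrite leq_mul2r leqnSn orbT.
have le_good : #|{: X}| <= 2 * #|good|.
  by move: le_bad; rewrite -(cardsC good) !mul2n -!addnn leq_add2r leq_add2l.
have sub : good \subset \bigcup_c [set x | hamming x (dec c) <= L].
  by apply/subsetP=> x; rewrite inE => gx; apply/bigcupP; exists (enc x); rewrite // inE.
have : #|good| <= #|C| * 2 ^ (7 * L).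
  apply: leq_trans (subset_leq_card sub) _; rewrite -sum_nat_const.
  elim/big_rec2: _ => [|c k U _ leU]; first by rewrite cards0.
  apply: leq_trans (leq_card_setU _ _) _; exact: leq_add (card_hamming_ball _) leU.
rewrite -(leq_pmul2l (isT : 0 < 2)) => /(leq_trans le_good).
rewrite card_ffun card_bool cardI mulnA -[16]/(9 + 7) mulnDl expnD.
by rewrite leq_pmul2r ?expn_gt0.
Qed.

End HammingBall.

Lemma card_exists_le (U V : finType) (P : U -> V -> bool) :
  #|[pred u | [exists v, P u v]]| <= \sum_v #|[pred u | P u v]|.
Proof.
rewrite -sum1_card big_mkcond /= (eq_bigr (fun v => \sum_u P u v)); last first.
  move=> v _; rewrite -sum1_card big_mkcond /=; apply: eq_bigr => u _.
  by rewrite inE; case: (P u v).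
rewrite exchange_big; apply: leq_sum => u _; rewrite inE.
by case: ifP => // /existsP[v Puv]; rewrite (bigD1 v) //= Puv.
Qed.

(* Bob cannot query the helper, but he can try every annotation: with k
   independent copies of the random string, a wrong annotation convinces all the
   copies with probability at most 3^-k, which pays for the union bound. *)
Lemma index_bound (I Om Mem Ann : finType) (L k : nat)
    (alice : Om -> {ffun I -> bool} -> Mem) (bob : Om -> Mem -> I -> Ann -> bool) :
  #|I| = 16 * L -> 0 < #|Om| -> 32 * #|Ann| <= 3 ^ k ->
  (forall (x : {ffun I -> bool}) i, x i -> exists a, forall w, bob w (alice w x) i a) ->
  (forall (x : {ffun I -> bool}) i a, ~~ x i -> 3 * #|[pred w | bob w (alice w x) i a]| <= #|Om|) ->
  2 ^ (9 * L) <= 2 * #|Mem| ^ k.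
Proof.
move=> cI Om0 le_ann compl sound3.
pose Oms := {ffun 'I_k -> Om}.
pose enc (ws : Oms) (x : {ffun I -> bool}) := [ffun j => alice (ws j) x].
pose dec (ws : Oms) (M : {ffun 'I_k -> Mem}) : {ffun I -> bool} :=
  [ffun i => [exists a, forall j, bob (ws j) (M j) i a]].
pose err ws (x : {ffun I -> bool}) i := x i != dec ws (enc ws x) i.
(* Errors are one-sided: where [x i] holds, a single annotation convinces all copies. Elsewhere the
   union bound over the annotations applies. *)
have errE (x : {ffun I -> bool}) i : 32 * #|[pred ws | err ws x i]| <= #|{: Oms}|.
  have [xi|xi] := boolP (x i).
    rewrite eq_card0 ?muln0 // => ws; rewrite !inE /err xi ffunE.
    have [a Ha] := compl x i xi; apply/negbTE; rewrite negbK eq_sym eqb_id /=.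
    by apply/existsP; exists a; apply/forallP=> j; rewrite ffunE.
  rewrite -(leq_pmul2r (m := 3 ^ k)) ?expn_gt0 //.
  apply: (@leq_trans (32 *
    (\sum_(a : Ann) #|[pred ws : Oms | [forall j, bob (ws j) (alice (ws j) x) i a]]|) * 3 ^ k)).
    rewrite leq_mul2r leq_mul2l /=; apply/orP; right.
    apply: leq_trans (card_exists_le _); apply: subset_leq_card; apply/subsetP=> ws.
    rewrite !inE /err (negPf xi) ffunE /= eq_sym eqbF_neg negbK => /existsP[a /forallP Ha].
    by apply/existsP; exists a; apply/forallP=> j; move: (Ha j); rewrite ffunE.
  apply: (@leq_trans (32 * (\sum_(a : Ann) #|{: Oms}|))); last first.
    by rewrite sum_nat_const mulnA mulnC leq_mul.
  rewrite -mulnA leq_mul2l big_distrl /=; apply: leq_sum => a _.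
  have -> : #|[pred ws : Oms | [forall j, bob (ws j) (alice (ws j) x) i a]]| =
            #|[pred w | bob w (alice w x) i a]| ^ k.
    rewrite -[k in RHS]card_ord -card_ffun_on; apply: eq_card => ws.
    by rewrite !inE; apply: eq_forallb.
  by rewrite -expnMn mulnC card_ffun card_ord leq_expl // sound3.
(* Averaging fixes the random strings: some [ws] errs on at most 1/32 of the pairs (x, i). *)
have [ws Hws] : exists ws : Oms, 32 * \sum_x \sum_i err ws x i <= #|{: {ffun I -> bool}}| * #|I|.
  apply/existsP; apply: contraT; rewrite negb_exists => /forallP H.
  have: \sum_(ws : Oms) (#|{: {ffun I -> bool}}| * #|I|).+1
      <= \sum_(ws : Oms) 32 * \sum_x \sum_i err ws x i.
    by apply: leq_sum => ws _; rewrite ltnNge H.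
  have -> : \sum_(ws : Oms) 32 * \sum_x \sum_i err ws x i
          = \sum_x \sum_i 32 * #|[pred ws | err ws x i]|.
    rewrite -big_distrr /= exchange_big /= big_distrr; apply: eq_bigr => x _ /=.
    rewrite exchange_big /= big_distrr; apply: eq_bigr => i _ /=; congr (_ * _).
    rewrite -sum1_card [RHS]big_mkcond; apply: eq_bigr => w _.
    by rewrite inE; case: (err _ _ _).
  have : \sum_(x : {ffun I -> bool}) \sum_i 32 * #|[pred ws | err ws x i]|
      <= \sum_(x : {ffun I -> bool}) \sum_(i : I) #|{: Oms}|.
    by apply: leq_sum => x _; apply: leq_sum => i _.
  move=> le1 /leq_trans/(_ le1); rewrite !sum_nat_const mulnA mulnC.
  by rewrite leq_pmul2r ?ltnn // card_ffun expn_gt0 Om0.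
apply: leq_trans (@code_bound I L cI _ (enc ws) (dec ws) _) _; last first.
  by rewrite card_ffun card_ord.
(* With 16 L positions, an error rate of 1/32 is the average of L / 2 errors that [code_bound]
   allows. *)
rewrite -(leq_pmul2l (isT : 0 < 16)) mulnA; apply: leq_trans Hws _.
by rewrite cI mulnC mulnA.
Qed.

(** * The graph that codes a bit matrix and an index *)

Section Gadget.
Variables (s n m : nat).

(* A node is inl (i, right, pendant), or one of the two ends inr _ of the dummy
   edge, which stands in for absent edges so that Alice's part of the stream has
   s^2 tokens whatever her input. *)
Definition node : finType := (('I_s * bool * bool) + bool)%type.

Lemma card_node : #|node| = 4 * s + 2.
Proof. by rewrite card_sum !card_prod card_ord card_bool -mulnA mulnC. Qed.

Hypothesis le_node : #|node| <= #|'I_n|.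
Let g : node -> 'I_n := embed le_node.

Definition link (a b : node) : {set 'I_n} := [set g a; g b].

Lemma card_link a b : a != b -> #|link a b| == 2.
Proof. by move=> ab; rewrite cards2 (inj_eq (@embed_inj _ _ _)) ab. Qed.

Lemma disjoint_link a b c d : a != c -> a != d -> b != c -> b != d ->
  [disjoint link a b & link c d].
Proof.
move=> ac ad bc bd; rewrite disjoints_subset; apply/subsetP=> x.
by rewrite !inE => /orP[]/eqP->; rewrite !(inj_eq (@embed_inj _ _ _)) negb_or ?ac ?ad ?bc ?bd.
Qed.

Definition left_node i : node := inl (i, false, false).
Definition right_node i : node := inl (i, true, false).
Definition left_pendant i : node := inl (i, false, true).
Definition right_pendant i : node := inl (i, true, true).

Definition dummy_edge : edge n := Sub (link _ _) (card_link (isT : inr false != inr true :> node)).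

Fact left_right_neq i j : left_node i != right_node j.
Proof. by apply/eqP. Qed.
Fact left_pendant_neq i : left_node i != left_pendant i.
Proof. by apply/eqP. Qed.
Fact right_pendant_neq i : right_node i != right_pendant i.
Proof. by apply/eqP. Qed.

Definition entry_edge i j : edge n := Sub (link _ _) (card_link (left_right_neq i j)).
Definition left_edge i : edge n := Sub (link _ _) (card_link (left_pendant_neq i)).
Definition right_edge i : edge n := Sub (link _ _) (card_link (right_pendant_neq i)).

Definition alice_stream (x : {ffun 'I_s * 'I_s -> bool}) : seq (edge n) :=
  [seq if x p then entry_edge p.1 p.2 else dummy_edge | p <- enum {: 'I_s * 'I_s}].

(** Dummy edges replace the two omitted pendant edges and pad the stream, so its length is [m] for
    every index. *)
Definition bob_stream (p : 'I_s * 'I_s) : seq (edge n) :=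
  [seq if i == p.1 then dummy_edge else left_edge i | i <- enum 'I_s] ++
  [seq if j == p.2 then dummy_edge else right_edge j | j <- enum 'I_s] ++
  nseq (m - (s ^ 2 + 2 * s)) dummy_edge.

Lemma size_index_stream x p : s ^ 2 + 2 * s <= m -> size (alice_stream x ++ bob_stream p) == m.
Proof.
move=> le_m; rewrite /alice_stream /bob_stream !size_cat !size_map size_nseq -!enumT -!cardT.
rewrite card_prod !card_ord.
by rewrite 2!addnA -(addnA (s * s)) addnn -mul2n mulnn subnKC.
Qed.

Hypothesis le_m : s ^ 2 + 2 * s <= m.
Definition index_stream x p : stream n m := Tuple (size_index_stream x p le_m).

Lemma mem_index_stream x p e : e \in index_stream x p ->
  [\/ e = dummy_edge, (exists2 q, x q & e = entry_edge q.1 q.2),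
      (exists2 i, i != p.1 & e = left_edge i) | (exists2 j, j != p.2 & e = right_edge j)].
Proof.
rewrite memtE /= !mem_cat => /or4P[/mapP[q _]|/mapP[i _]|/mapP[j _]|].
- by case: ifP => xq ->; [constructor 2; exists q|constructor 1].
- by case: eqVneq => ip ->; [constructor 1|constructor 3; exists i].
- by case: eqVneq => jp ->; [constructor 1|constructor 4; exists j].
by rewrite mem_nseq => /andP[_ /eqP->]; constructor 1.
Qed.

Lemma index_stream_entry (x : {ffun 'I_s * 'I_s -> bool}) p q :
  x q -> entry_edge q.1 q.2 \in index_stream x p.
Proof.
move=> xq; rewrite memtE /= mem_cat; apply/orP; left; apply/mapP; exists q.
  by rewrite mem_enum.
by rewrite xq.
Qed.

Lemma index_stream_dummy x p : dummy_edge \in index_stream x p.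
Proof.
rewrite memtE /= !mem_cat; apply/or4P; constructor 2; apply/mapP; exists p.1.
  by rewrite mem_enum.
by rewrite eqxx.
Qed.

Lemma index_stream_left x p i : i != p.1 -> left_edge i \in index_stream x p.
Proof.
move=> /negPf ip; rewrite memtE /= !mem_cat; apply/or4P; constructor 2; apply/mapP; exists i.
  by rewrite mem_enum.
by rewrite ip.
Qed.

Lemma index_stream_right x p i : i != p.2 -> right_edge i \in index_stream x p.
Proof.
move=> /negPf ip; rewrite memtE /= !mem_cat; apply/or4P; constructor 3; apply/mapP; exists i.
  by rewrite mem_enum.
by rewrite ip.
Qed.

(** The pendant edges contribute [2 * (s - 1)]; the entry edge at [p] and the dummy edge, which take
    the places of the two omitted ones, contribute the other two. *)
Lemma index_stream_one (x : {ffun 'I_s * 'I_s -> bool}) p :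
  x p -> 2 * s <= max_matching_size (index_stream x p).
Proof.
move=> xp.
pose h (z : 'I_s + 'I_s) : {set 'I_n} := match z with
  | inl i => if i == p.1 then val (entry_edge p.1 p.2) else val (left_edge i)
  | inr j => if j == p.2 then val dummy_edge else val (right_edge j) end.
have -> : 2 * s = #|{: 'I_s + 'I_s}| by rewrite card_sum card_ord addnn mul2n.
rewrite max_matching_sizeE; apply: (@leq_nu_indexed _ _ _ h).
- exact: graph_edge_set.
- by case=> i; rewrite /h; case: eqVneq => ip; rewrite mem_edge_set;
    [apply: index_stream_entry|apply: index_stream_left
    |apply: index_stream_dummy|apply: index_stream_right].
have dis a b c d := @disjoint_link a b c d.
by move=> [i|i] [j|j] /eqP ij /=; case: eqP => ip; case: eqP => jp;
  apply: dis; apply/eqP; rewrite /left_node /right_node /left_pendant /right_pendant;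
  congruence.
Qed.

(** The left nodes but [p.1], the right nodes but [p.2] and one end of the dummy edge are
    [2 * s - 1] vertices that cover every edge, since only the entry edge at [p] could avoid
    them. *)
Lemma index_stream_zero (x : {ffun 'I_s * 'I_s -> bool}) p :
  ~~ x p -> max_matching_size (index_stream x p) < 2 * s.
Proof.
move=> xp.
pose S := [set g (left_node i) | i in [set~ p.1]] :|:
          [set g (right_node i) | i in [set~ p.2]] :|: [set g (inr true)].
have cS : #|S| < 2 * s.
  have s0 : 0 < s by apply: leq_ltn_trans (leq0n _) (ltn_ord p.1).
  have H (f : 'I_s -> 'I_n) q : #|[set f i | i in [set~ q]]| <= s.-1.
    by apply: leq_trans (leq_imset_card _ _) _; rewrite cardsC1 card_ord.
  apply: (@leq_trans (s.-1 + s.-1 + 1).+1); last by rewrite addn1 addnn -doubleS prednK // mul2n.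
  rewrite ltnS; apply: leq_trans (leq_card_setU _ _) _; rewrite cards1 leq_add2r.
  by apply: leq_trans (leq_card_setU _ _) _; apply: leq_add.
rewrite max_matching_sizeE;
have [M /andP[mM /eqP <-]] := maximum_exists (edge_set (index_stream x p)).
apply: leq_ltn_trans cS.
have := @odd_cover_bound _ 'I_0 _ M S (fun _ => set0) (graph_edge_set _) mM.
rewrite big_ord0 addn0; apply=> _ /imsetP[e eA ->]; left.
case: (mem_index_stream eA) => [->|[q xq ->]|[i ip ->]|[i ip ->]].
- by exists (g (inr true)); [exact: set22|rewrite !inE eqxx orbT].
- have [q1|q1] := eqVneq q.1 p.1; last first.
    exists (g (left_node q.1)); first exact: set21.
    by apply/setUP; left; apply/setUP; left; apply/imsetP; exists q.1; rewrite // !inE.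
  have q2 : q.2 != p.2.
    by apply: contra xp => /eqP q2; rewrite (surjective_pairing p) -q1 -q2 -surjective_pairing.
  exists (g (right_node q.2)); first exact: set22.
  by apply/setUP; left; apply/setUP; right; apply/imsetP; exists q.2; rewrite // !inE.
- exists (g (left_node i)); first exact: set21.
  by apply/setUP; left; apply/setUP; left; apply/imsetP; exists i; rewrite // !inE.
exists (g (right_node i)); first exact: set21.
by apply/setUP; left; apply/setUP; right; apply/imsetP; exists i; rewrite // !inE.
Qed.

End Gadget.

(** * From a valid protocol to the indexing problem *)

Section LowerBound.
Variables (n m : nat) (P : protocol n m).
Hypothesis validP : valid_protocol (@max_matching_size n m) P.
Notation V := (the_verifier P).
Notation hc := (help_cost P).

(** Alice's message is the verifier's memory after her part of the stream; Bob resumes the run and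
    accepts an output of at least [2 * s]. The number [k] of copies makes 3^k exceed 32 times the
    number of annotations, as 3^8 > 64. *)
Lemma protocol_index_bound s L : 4 * s + 2 <= n -> s ^ 2 + 2 * s <= m -> s ^ 2 = 16 * L ->
  9 * L <= (2 * hc + 8) * verification_cost P + 1.
Proof.
move=> le_n le_m sL; set k := 2 * hc + 8.
have le_node : #|node s| <= #|'I_n| by rewrite card_node card_ord.
have [compl sound3] := validP.
pose bob (R : (rand_bits V).-tuple bool) mem p (a : hc.-bseq bool) :=
  if output R (foldl (read_annotation R) (foldl (read_edge R) mem (bob_stream m le_node p)) a)
  is Some y then 2 * s <= y else false.
pose alice (R : (rand_bits V).-tuple bool) x :=
  foldl (read_edge R) (start R) (alice_stream le_node x).
have bobE R x p (a : hc.-bseq bool) : bob R (alice R x) p a =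
  if out (index_stream le_node le_m x p) R a is Some y then 2 * s <= y else false.
  by rewrite /bob /alice /out /= foldl_cat.
suff : 2 ^ (9 * L) <= 2 * #|{: (memory_bits V).-tuple bool}| ^ k.
  by rewrite card_tuple card_bool -expnM -expnS leq_exp2l // addn1 mulnC (mulnC k).
apply: (@index_bound _ _ _ (hc.-bseq bool) L k alice bob).
- by rewrite card_prod card_ord mulnn.
- exact: card_rand.
- apply: (@leq_trans (32 * 2 ^ hc.+1)); first by rewrite leq_mul2l ltnW ?card_bseq_bool.
  rewrite /k expnD expnM expnS mulnA mulnC; apply: leq_mul => //.
  exact: leq_expl.
- move=> x p xp; have sH : size (the_helper P (index_stream le_node le_m x p)) <= hc.
    by rewrite /help_cost (leq_bigmax (F := fun A => size (the_helper P A))).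
  exists (Bseq sH) => R; rewrite bobE /=.
  have /prob_eq1/(_ R)/eqP-> := compl (index_stream le_node le_m x p).
  exact: index_stream_one.
move=> x p a xp; have lt_nu := index_stream_zero le_node le_m xp.
(* Soundness is used for the constant helper sending [a]: a valid [a] yields a size below [2 * s],
   which Bob rejects, and an invalid one convinces at most a third of the random strings. *)
have [/prob_eq1 va|] := sound3 (fun _ => a : seq bool) (index_stream le_node le_m x p).
  rewrite eq_card0 ?muln0 // => R; rewrite !inE bobE.
  by move/eqP: (va R) => /= ->; rewrite leqNgt lt_nu.
rewrite prob_le3; apply: leq_trans; rewrite leq_mul2l /=.
apply: subset_leq_card; apply/subsetP=> R; rewrite !inE bobE /in_mem /=.
by case: (out _ _ _).
Qed.

End LowerBound.

(** A gadget of side [4 * t], with [t] about n / (32 (D + 1)), fits both into the nodes and into the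
    stream, and it codes [16 * t ^ 2] bits. *)
Lemma help_verification_tradeoff D n m (P : protocol n m) :
  32 * D.+1 <= n -> n ^ 2 <= D.+1 * m ->
  valid_protocol (@max_matching_size n m) P ->
  n ^ 2 <= (64 * D.+1) ^ 2 * 10 * (maxn 1 (help_cost P) * verification_cost P).
Proof.
move=> le_n le_m vP.
pose t := n %/ (32 * D.+1).
have t0 : 0 < t by rewrite divn_gt0 ?muln_gt0.
have le_t : 32 * D.+1 * t <= n by rewrite mulnC leq_divM.
have le32 : 32 * t <= n by apply: leq_trans le_t; rewrite leq_mul2r leq_pmulr ?orbT.
have le64 : n <= 64 * D.+1 * t.
  have /ltnW/leq_trans : n < 32 * D.+1 * t.+1 by rewrite mulnC; apply: ltn_ceil; rewrite muln_gt0.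
  by apply; rewrite -[64]/(32 * 2) -!mulnA leq_mul2l /= mulnCA leq_mul2l /=
    mul2n -addnn -addn1 leq_add2l.
(* The gadget uses 16 t^2 + 8 t tokens, at most 24 t^2. *)
have le_mt : 24 * t ^ 2 <= m.
  have: (32 * D.+1 * t) ^ 2 <= D.+1 * m by apply: leq_trans le_m; rewrite leq_sqr.
  rewrite -mulnA mulnCA expnMn -mulnn -mulnA leq_pmul2l //.
  apply: leq_trans; apply: leq_trans (leq_pmull _ (ltn0Sn D)).
  by rewrite expnMn leq_mul.
have := @protocol_index_bound n m P vP (4 * t) (t ^ 2).
have t2 : t <= t ^ 2 by rewrite -mulnn leq_pmulr.
have t2' : 1 <= t ^ 2 by rewrite expn_gt0 t0.
have le_s : 4 * (4 * t) + 2 <= n.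
  by apply: leq_trans le32; rewrite mulnA (mulnDl 16 16 t) leq_add2l
    (leq_trans _ (leq_pmulr 16 t0)).
have le_m' : (4 * t) ^ 2 + 2 * (4 * t) <= m.
  apply: leq_trans le_mt; rewrite expnMn mulnA (mulnDl 16 8 (t ^ 2)) leq_add2l.
  by rewrite leq_mul2l t2 orbT.
move=> /(_ le_s le_m'); rewrite expnMn => /(_ erefl) le9.
(* One of the nine copies of [t ^ 2] absorbs the additive 1, and 2 h + 8 is at most 10 times the
   maximum of 1 and h. *)
have le8 : 8 * t ^ 2 <= 10 * (maxn 1 (help_cost P) * verification_cost P).
  rewrite mulnA -(leq_add2r 1); apply: leq_trans (leq_trans le9 _).
    by rewrite (mulnDl 8 1 (t ^ 2)) leq_add2l mul1n.
  rewrite leq_add2r leq_mul2r; apply/orP; right; rewrite (mulnDl 2 8 (maxn _ _)).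
  by rewrite leq_add ?leq_mul2l ?leq_maxr ?leq_pmulr // leq_max.
rewrite -mulnA; apply: (@leq_trans ((64 * D.+1 * t) ^ 2)); first by rewrite leq_sqr.
by rewrite expnMn leq_mul2l; apply/orP; right; apply: leq_trans le8; rewrite leq_pmull.
Qed.

(** * Running a machine over words as a verifier *)

(* A machine over an alphabet W of words, with finite state set and source of
   randomness, is run by a verifier that buffers the bits of the current word. *)
Section Compile.
Variables (n : nat) (Om St W : finType) (r b w : nat).
Hypotheses (cOm : #|{: r.-tuple bool}| = #|Om|) (w0 : 0 < w).
Hypothesis cSt : #|{: St * w.-bseq bool}| <= #|{: b.-tuple bool}|.
Hypothesis cW : #|W| <= #|{: w.-tuple bool}|.
Variables (s0 : St) (read_e : Om -> St -> edge n -> St) (read_w : Om -> St -> W -> St).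
Variable out_s : St -> option nat.

Definition decode_block (s : seq bool) : option W :=
  obind (unembed cW) (insub s : option (w.-tuple bool)).

(** Blocks that code no word are skipped and an incomplete last block is dropped, so every
    annotation, honest or not, is read as some sequence of words. *)
Definition decode_step (p : seq W * seq bool) (c : bool) : seq W * seq bool :=
  let buf := rcons p.2 c in
  if size buf == w then (if decode_block buf is Some x then rcons p.1 x else p.1, [::])
  else (p.1, buf).

Definition decode (a : seq bool) : seq W := (foldl decode_step ([::], [::]) a).1.
Definition encode (ws : seq W) : seq bool := flatten [seq tval (embed cW x) | x <- ws].

Lemma size_encode ws : size (encode ws) = size ws * w.
Proof. by elim: ws => //= x ws IH; rewrite size_cat size_tuple IH mulSn. Qed.

Lemma decode_blockK x : decode_block (embed cW x) = Some x.
Proof. by rewrite /decode_block valK /= embedK. Qed.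

Lemma foldl_decode_step ws buf s : s != [::] -> size (buf ++ s) = w ->
  foldl decode_step (ws, buf) s =
  (if decode_block (buf ++ s) is Some x then rcons ws x else ws, [::]).
Proof.
elim: s buf => // c [|c' s] IH buf _ sz.
  by rewrite /= /decode_step /= -cats1 sz eqxx.
have stepE : decode_step (ws, buf) c = (ws, rcons buf c).
  rewrite /decode_step /= ifN // -sz size_cat size_rcons /= addnS eqSS.
  by rewrite -{1}[size buf]addn0 eqn_add2l.
transitivity (foldl decode_step (decode_step (ws, buf) c) (c' :: s)); first by [].
by rewrite stepE IH ?cat_rcons.
Qed.

Lemma encodeK : cancel encode decode.
Proof.
move=> ws; rewrite /decode.
suff H ws0 : foldl decode_step (ws0, [::]) (encode ws) = (ws0 ++ ws, [::]) by rewrite H.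
elim: ws ws0 => [|x ws IH] ws0; first by rewrite cats0.
rewrite /encode /= foldl_cat foldl_decode_step; last by rewrite size_tuple.
  by rewrite decode_blockK IH cat_rcons.
by rewrite -size_eq0 size_tuple -lt0n.
Qed.

Let pack : St * w.-bseq bool -> b.-tuple bool := embed cSt.
(** The default value stands for memory contents outside the image of [pack], which no run of the
    verifier reaches. *)
Let unpack (M : b.-tuple bool) : St * w.-bseq bool := odflt (s0, [bseq]) (unembed cSt M).
Let rand : r.-tuple bool -> Om := embed (eq_leq cOm).

Lemma packK : cancel pack unpack.
Proof. by move=> u; rewrite /unpack embedK. Qed.

Definition read_bit (o : Om) (p : St * w.-bseq bool) (c : bool) : St * w.-bseq bool :=
  let buf := rcons p.2 c in
  if size buf == w then
    (if decode_block buf is Some x then read_w o p.1 x else p.1, [bseq])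
  else (p.1, insub_bseq w buf).

Definition compile : verifier n :=
  @Verifier n r b (fun _ => pack (s0, [bseq]))
    (fun R M e => pack (read_e (rand R) (unpack M).1 e, (unpack M).2))
    (fun R M c => pack (read_bit (rand R) (unpack M) c))
    (fun _ M => out_s (unpack M).1).

Definition run (o : Om) (A : seq (edge n)) (ws : seq W) : St :=
  foldl (read_w o) (foldl (read_e o) s0 A) ws.

(** Simulation invariant: the words collected by [decode_step] are exactly those already processed,
    and the partial block is short enough for the bounded buffer. *)
Lemma foldl_read_bit o s a :
  let q := foldl (read_bit o) (s, [bseq]) a in
  let p := foldl decode_step ([::], [::]) a in
  [/\ q.1 = foldl (read_w o) s p.1, q.2 = p.2 :> seq bool & size p.2 < w].
Proof.
elim/last_ind: a => [|a c] //=; rewrite !foldl_rcons.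
case: (foldl (read_bit _) _ _) => s' buf; case: (foldl decode_step _ _) => ws buf' /=.
move=> [-> eq_buf lt_w]; rewrite /read_bit /decode_step /= eq_buf; case: eqVneq => sz /=.
  by split=> //; case: (decode_block _) => // x; rewrite foldl_rcons.
have lt_w' : size (rcons buf' c) < w by rewrite ltn_neqAle sz size_rcons.
by split=> //; rewrite /insub_bseq insubdK //; apply: ltnW.
Qed.

Lemma out_compile m (A : stream n m) R a :
  @out n m compile A R a = out_s (run (rand R) A (decode a)).
Proof.
rewrite /out /compile /run /= .
have -> : foldl (fun M e => pack (read_e (rand R) (unpack M).1 e, (unpack M).2))
             (pack (s0, [bseq])) A = pack (foldl (read_e (rand R)) s0 A, [bseq]).
  by elim: (tval A) s0 => //= e s IH s1; rewrite packK IH.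
have H : forall q, foldl (fun M c => pack (read_bit (rand R) (unpack M) c)) (pack q) a
       = pack (foldl (read_bit (rand R)) q a).
  by elim: a => //= c a IH q; rewrite packK IH.
by rewrite H packK; have [-> _ _] := foldl_read_bit (rand R) (foldl (read_e (rand R)) s0 A) a.
Qed.

Lemma compile_always m (A : stream n m) a y :
  (forall o, out_s (run o A (decode a)) = y) <->
  (forall R, @out n m compile A R a == y).
Proof.
split=> [H R|H o]; first by rewrite out_compile H.
have [g _ gK] := inj_card_bij (@embed_inj _ _ (eq_leq cOm)) (eq_leq (esym cOm)).
by have := H (g o); rewrite out_compile /rand gK => /eqP.
Qed.

Lemma compile_card m (A : stream n m) a (Q : pred (option nat)) :
  #|[pred R | Q (@out n m compile A R a)]| = #|[pred o | Q (out_s (run o A (decode a)))]|.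
Proof.
rewrite -[RHS](@card_embed_preim _ _ (eq_leq cOm) _ cOm); apply: eq_card => R.
by rewrite !inE out_compile.
Qed.

End Compile.

(** * The certificate and its verification *)

Section Certificate.
Variable n : nat.
Notation T := 'I_n.

(** Label 0 marks the ends of matching edges, label 1 the vertices of S, and label 2 + c the members
    of the set named c. *)
Definition label : finType := 'I_n.+2.
Definition incidence : finType := (label * T)%type.
Definition label_matching : label := @Ordinal n.+2 0 isT.
Definition label_cover : label := @Ordinal n.+2 1 isT.
Definition label_class (c : T) : label := rshift 2 c.

(* (e, (star, u), flag): the edge e, in the matching when flag holds, is covered
   by its end u if star holds, and otherwise lies inside the odd set named u.
   When star holds but u is not an end of e, emit falls back to the latter. *)
Definition entry : finType := (edge n * (bool * T) * bool)%type.

Definition emit (x : entry) : seq incidence :=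
  let: (e, (star, u), flag) := x in
  (if flag then [seq (label_matching, v) | v <- enum (val e)] else [::]) ++
  (if star && (u \in val e) then [:: (label_cover, u)]
   else [seq (label_class u, v) | v <- enum (val e)]).

Lemma size_emit x : size (emit x) <= 4.
Proof.
case: x => [[e [star u]] flag]; have /eqP ce := valP e.
by rewrite size_cat; do 2!case: ifP => _; rewrite ?size_map -?cardE ?ce.
Qed.

Lemma mem_pair_map (c d : label) (S : {set T}) v :
  ((c, v) \in [seq (d, u) | u <- enum S]) = (c == d) && (v \in S).
Proof.
apply/mapP/andP => [[u uS [-> ->]]|[/eqP-> vS]]; first by rewrite eqxx -mem_enum.
by exists v; rewrite ?mem_enum.
Qed.

Lemma emit_matching e star u flag v :
  ((label_matching, v) \in emit (e, (star, u), flag)) = flag && (v \in val e).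
Proof.
rewrite mem_cat; case: flag; case: ifP => _; rewrite ?mem_pair_map ?inE ?xpair_eqE //=.
  by rewrite orbF.
by rewrite orbF.
Qed.

Lemma emit_cover e star u flag v :
  ((label_cover, v) \in emit (e, (star, u), flag)) = [&& star, u \in val e & v == u].
Proof.
rewrite mem_cat andbA; case: flag; case: ifP => _; rewrite ?mem_pair_map ?inE ?xpair_eqE //=.
Qed.

Lemma emit_class e star u flag c v :
  ((label_class c, v) \in emit (e, (star, u), flag)) =
  [&& ~~ (star && (u \in val e)), c == u & v \in val e].
Proof.
rewrite mem_cat; case: flag; case: ifP => _; rewrite ?mem_pair_map ?inE ?xpair_eqE //=;
  by rewrite (inj_eq (@rshift_inj _ _)).
Qed.

Definition incidences (E : seq entry) : seq incidence := flatten (map emit E).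

(** Being a set, a layer counts a repeated incidence once. *)
Definition layer (L : seq incidence) (c : label) : {set T} := [set v | (c, v) \in L].

Definition matching_count (L : seq incidence) := #|layer L label_matching|./2.

Definition cover_count (L : seq incidence) :=
  #|layer L label_cover| + \sum_u #|layer L (label_class u)|./2.

Definition item : finType := (edge n + incidence)%type.

(** The tags [inl] and [inr] merge the two multiset equalities into one, so that a single
    fingerprint per side checks both. *)
Definition debit (A : seq (edge n)) (E : seq entry) : seq item :=
  map inl A ++ map inr (incidences E).
Definition credit (E : seq entry) (L : seq incidence) : seq item :=
  map inl (map (fun x => x.1.1) E) ++ map inr L.

Section Consistent.
Variables (m : nat) (A : stream n m) (E : seq entry) (L : seq incidence).
Hypothesis bal : perm_eq (debit A E) (credit E L).

Lemma mem_entries e : (e \in A) = (e \in [seq x.1.1 | x <- E]).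
Proof.
have /(_ (inl e)) := perm_mem bal; rewrite !mem_cat !(mem_map (@inl_inj _ _)).
suff N (s : seq incidence) : (inl e : item) \in map inr s = false by rewrite !N !orbF.
by apply/negP=> /mapP[].
Qed.

Lemma mem_incidences i : (i \in L) = (i \in incidences E).
Proof.
have /(_ (inr i)) := perm_mem bal; rewrite !mem_cat !(mem_map (@inr_inj _ _)).
suff N (s : seq (edge n)) : (inr i : item) \in map inl s = false by rewrite !N.
by apply/negP=> /mapP[].
Qed.

Lemma mem_incidencesP i : reflect (exists2 x, x \in E & i \in emit x) (i \in L).
Proof. by rewrite mem_incidences; apply: (iffP flatten_mapP). Qed.

(** Bounds all the counts of a balanced certificate; this limits the annotation length and keeps the
    machine's counters from saturating. *)
Lemma size_balance : size E = m /\ size L <= 4 * m.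
Proof.
have cnt (s : seq (edge n)) (t : seq incidence) :
    count (fun i : item => if i is inl _ then true else false) (map inl s ++ map inr t) = size s.
  by rewrite count_cat !count_map count_predT (eq_count (a2 := pred0)) ?count_pred0 ?addn0.
have sE : size E = m.
  have := permP bal (fun i => if i is inl _ then true else false).
  by rewrite !cnt size_map size_tuple.
split=> //; have /eqP := perm_size bal.
rewrite !size_cat !size_map size_tuple sE eqn_add2l => /eqP <-.
rewrite -sE; elim: (E) => //= x E' IH.
by rewrite /incidences /= size_cat mulnS leq_add ?size_emit.
Qed.

(** Every streamed edge occurs in an entry, whose emitted incidences place one of its ends in the
    cover layer or both ends in one class layer; weak duality then applies. *)
Lemma max_matching_le_cover : max_matching_size A <= cover_count L.
Proof.
rewrite max_matching_sizeE; have [N /andP[mN /eqP <-]] := maximum_exists (edge_set A).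
apply: (odd_cover_bound (graph_edge_set A) mN) => _ /imsetP[e eA ->].
move: eA; rewrite mem_entries => /mapP[[[e' [star u]] flag] xE /= ->].
have [/andP[st ue]|cl] := boolP (star && (u \in val e')).
  left; exists u => //; rewrite inE; apply/mem_incidencesP.
  by exists (e', (star, u), flag); [exact: xE|rewrite emit_cover st ue /=].
right; exists u; apply/subsetP=> v ve; rewrite inE; apply/mem_incidencesP.
by exists (e', (star, u), flag); [exact: xE|rewrite emit_class cl eqxx].
Qed.

Definition flagged : {set {set T}} := [set val (x.1.1) | x in E & x.2].

Lemma layer_matching : layer L label_matching = cover flagged.
Proof.
apply/setP=> v; rewrite inE; apply/mem_incidencesP/bigcupP.
  move=> [[[e [star u]] flag] xE]; rewrite emit_matching => /andP[fl ve].
  by exists (val e) => //; apply/imsetP; exists (e, (star, u), flag); rewrite ?inE ?xE.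
move=> [_ /imsetP[[[e [star u]] flag] + ->] ve]; rewrite inE => /andP[xE fl].
by exists (e, (star, u), flag); rewrite // emit_matching ve andbT.
Qed.

Lemma card_flagged : #|flagged| <= count snd E.
Proof.
rewrite -size_filter -(size_map (fun x : entry => val x.1.1)).
apply: leq_trans (card_size _); apply: subset_leq_card; apply/subsetP=> _ /imsetP[x + ->].
by rewrite inE => /andP[xE fl]; apply: map_f; rewrite mem_filter fl.
Qed.

(** The cover gives one inequality. For the other, the flagged edges cover at least twice as many
    vertices as there are flags, and there are at most as many such edges as flags; equality
    throughout forces them to be pairwise disjoint. *)
Lemma certificate_sound :
  count snd E = matching_count L -> count snd E = cover_count L ->
  count snd E = max_matching_size A.
Proof.
move=> eqM eqC; apply/eqP; rewrite eqn_leq eqC max_matching_le_cover andbT -eqC.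
have card2 e : e \in flagged -> #|e| = 2.
  by move=> /imsetP[x _ ->]; apply/eqP; apply: (valP x.1.1).
have sum2 : \sum_(e in flagged) #|e| = #|flagged| * 2.
  by rewrite -sum_nat_const; apply: eq_bigr => e /card2.
have le_cov : count snd E * 2 <= #|cover flagged|.
  by rewrite eqM /matching_count layer_matching muln2 -[leqRHS]odd_double_half leq_addl.
have [le_sum eq_sum] := leq_card_cover flagged; rewrite sum2 in le_sum eq_sum.
have eq_fl : #|flagged| = count snd E.
  apply/eqP; rewrite eqn_leq card_flagged.
  by rewrite -(leq_pmul2r (isT : 0 < 2)) (leq_trans le_cov).
rewrite -eq_fl max_matching_sizeE; apply: leq_nu; apply/andP; split.
  apply/subsetP=> _ /imsetP[x + ->]; rewrite inE => /andP[xE _].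
  by rewrite mem_edge_set mem_entries; apply: (map_f (fun x : entry => x.1.1)).
by rewrite -eq_sum eqn_leq le_sum eq_fl.
Qed.

End Consistent.

Lemma certificate_exists m (A : stream n m) :
  exists E, [/\ perm_eq A [seq x.1.1 | x <- E],
    count snd E = max_matching_size A,
    matching_count (incidences E) = max_matching_size A &
    cover_count (incidences E) = max_matching_size A].
Proof.
have gA := graph_edge_set A.
have [M maxM] := maximum_exists (edge_set A); have /andP[mM /eqP cM] := maxM.
have [S [B cov le_nu]] := odd_cover_exists gA.
have [asg asgP] : exists asg : edge n -> bool * T, forall e, e \in A ->
    if (asg e).1 then ((asg e).2 \in val e) && ((asg e).2 \in S) else val e \subset B (asg e).2.
  apply: (fin_all_exists (P := fun e y => e \in A ->
    if y.1 then (y.2 \in val e) && (y.2 \in S) else val e \subset B y.2)) => e.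
  have [eA|eA] := boolP (e \in A).
    have [|[u ue uS]|[c ec]] := cov (val e); first by rewrite mem_edge_set.
      by exists (true, u); rewrite /= ue.
    by exists (false, c).
  (* An edge outside the stream only needs some value, which one of its ends supplies. *)
  have /card_gt0P[u _] : 0 < #|val e| by rewrite (eqP (valP e)).
  by exists (true, u).
pose eM := enum [pred e : edge n | val e \in M].
(* One copy of each edge of [M] is split off the stream; only these copies are flagged, so parallel
   edges do not inflate the count. *)
have [rest permA] : exists rest, perm_eq A (eM ++ rest).
  have [s sA /permPl pM] : exists2 s, subseq s A & perm_eq eM s.
    apply/count_subseqP => e; rewrite count_uniq_mem ?enum_uniq // mem_enum inE.
    case: (boolP (val e \in M)) => //= eM'.
    rewrite -has_count has_pred1 -mem_edge_set; by case/andP: mM => /subsetP->.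
  have [rest pr] := perm_to_subseq sA.
  by exists rest; rewrite (permPl pr) perm_cat2r perm_sym pM.
pose E := [seq (e, asg e, true) | e <- eM] ++ [seq (e, asg e, false) | e <- rest].
have entE : [seq x.1.1 | x <- E] = eM ++ rest by rewrite map_cat -!map_comp !map_id.
have bal : perm_eq (debit A E) (credit E (incidences E)).
  by rewrite /debit /credit perm_cat2r perm_map // entE.
have sizeM : count snd E = max_matching_size A.
  rewrite count_cat !count_map (eq_count (a2 := predT)) // count_predT.
  rewrite (eq_count (a2 := pred0)) // count_pred0 addn0 max_matching_sizeE -cM.
  rewrite /eM -cardE -(card_imset _ val_inj); apply: eq_card => e.
  apply/imsetP/idP => [[f + ->] //|eM']; have : e \in edge_set A by case/andP: mM => /subsetP->.
  by move=> /imsetP[f _ ef]; exists f; rewrite // inE -ef.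
have asgE x : x \in E -> x.1.2 = asg x.1.1 /\ x.1.1 \in A.
  move=> xE; split; last by rewrite (perm_mem permA) -entE (map_f (fun x : entry => x.1.1)).
  by move: xE; rewrite mem_cat => /orP[] /mapP[e _ ->].
have flE : flagged E = M.
  apply/setP=> e; apply/imsetP/idP => [[x + ->]|eM'].
    by rewrite inE mem_cat => /andP[/orP[] /mapP[f + ->] //=]; rewrite mem_enum.
  have : e \in edge_set A by case/andP: mM => /subsetP->.
  move=> /imsetP[f _ ef]; exists (f, asg f, true) => //.
  rewrite inE andbT mem_cat; apply/orP; left; apply: (map_f (fun e => (e, asg e, true))).
  by rewrite mem_enum inE -ef.
exists E; split; rewrite ?entE //.
  rewrite /matching_count (layer_matching bal) flE (card_cover_matching gA mM) cM.
  by rewrite muln2 doubleK.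
apply/eqP; rewrite eqn_leq (max_matching_le_cover bal) andbT max_matching_sizeE.
apply: leq_trans le_nu; apply: leq_add.
  apply: subset_leq_card; apply/subsetP=> v; rewrite inE => /(mem_incidencesP bal).
  move=> [[[e [star u]] flag] /asgE[/= asge eA]]; rewrite emit_cover => /and3P[st _ /eqP->].
  by have := asgP e eA; rewrite -asge /= st => /andP[].
apply: leq_sum => c _; apply: half_leq.
apply: subset_leq_card; apply/subsetP=> v; rewrite inE => /(mem_incidencesP bal).
move=> [[[e [star u]] flag] /asgE[/= asge eA]]; rewrite emit_class => /and3P[st /eqP-> ve].
have := asgP e eA; rewrite -asge /=; case: star st {asge} => //= [|_ /subsetP-> //].
by move=> /negPf->.
Qed.

End Certificate.

(** * Random fingerprints of multisets *)

Lemma affine_inj c d X Y u v : c != d ->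
  c * u + X = d * u + Y -> c * v + X = d * v + Y -> u = v.
Proof.
move=> cd; wlog le_uv : u v / u <= v => [H|] E E'.
  by case: (leqP u v) => [/H|/ltnW/H H']; [apply|apply/esym/H'].
apply/eqP; rewrite eqn_leq le_uv -subn_eq0 /=.
move: E'; rewrite -{1 2}(subnK le_uv) !mulnDr -!addnA E => /addIn/eqP.
by rewrite eqn_mul2r (negPf cd) orbF.
Qed.

Section Fingerprint.
Variable I : finType.
Notation hash := {ffun I -> 'I_4}.

(** Four hash values suffice: the collision probability 1/4 lies below 1/3, and the sum stays linear
    in the number of items, hence of logarithmic bit length. *)
Definition fingerprint (h : hash) (s : seq I) := \sum_(i <- s) h i.

Lemma fingerprint_cat h s t : fingerprint h (s ++ t) = fingerprint h s + fingerprint h t.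
Proof. exact: big_cat. Qed.

Lemma fingerprint_perm h s t : perm_eq s t -> fingerprint h s = fingerprint h t.
Proof. exact: perm_big. Qed.

Lemma fingerprint_le h s : fingerprint h s <= 3 * size s.
Proof.
rewrite -sum1_size big_distrr; apply: leq_sum => i _.
by rewrite -ltnS; apply: ltn_ord.
Qed.

Lemma fingerprint_count h s : fingerprint h s = \sum_i count_mem i s * h i.
Proof.
elim: s => [|j s IH]; first by rewrite /fingerprint big_nil big1.
rewrite /fingerprint big_cons -/(fingerprint h s) IH (bigD1 j) //= [RHS](bigD1 j) //=.
rewrite eqxx mulnDl mul1n addnA; congr (_ + _); apply: eq_bigr => i ij.
by rewrite eq_sym (negPf ij).
Qed.

(* If i occurs differently often in s and t, then at most one of the four values
   of h at i makes the fingerprints agree. *)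
Lemma card_collision s t : ~~ perm_eq s t ->
  4 * #|[pred h : hash | fingerprint h s == fingerprint h t]| <= #|{: hash}|.
Proof.
move=> nperm; have [i ni] : exists i, count_mem i s != count_mem i t.
  apply/existsP; apply: contraR nperm; rewrite negb_exists => /forallP H.
  by apply/allP=> i _; move: (H i); rewrite negbK.
(* Overwriting the value at [i] is injective on pairs (v, h) with colliding [h]: the other values
   and the collision determine [h i]. *)
pose shift (p : 'I_4 * hash) : hash := [ffun j => if j == i then p.1 else p.2 j].
pose Q := [pred h : hash | fingerprint h s == fingerprint h t].
have inj : {in [pred p : 'I_4 * hash | Q p.2] &, injective shift}.
  move=> [v h] [v' h']; rewrite !inE /= => /eqP E /eqP E' /ffunP eq_sh.
  have vv : v = v' by have := eq_sh i; rewrite !ffunE eqxx.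
  have hh j : j != i -> h j = h' j by move=> /negPf ji; have := eq_sh j; rewrite !ffunE ji.
  suff hi : h i = h' i.
    by rewrite vv; congr pair; apply/ffunP=> j; have [->|/hh] := eqVneq j i.
  move: E E'; rewrite !fingerprint_count !(bigD1 i (P := xpredT)) //=.
  have sub u : \sum_(j | j != i) count_mem j u * h' j = \sum_(j | j != i) count_mem j u * h j.
    by apply: eq_bigr => j /hh->.
  rewrite !sub; move: (count_mem i s) (count_mem i t) (\sum_(j | _) _) (\sum_(j | _) _) ni.
  by move=> c d X Y cd E E'; apply/val_inj/(affine_inj cd E E').
have <- : #|[pred p : 'I_4 * hash | Q p.2]| = 4 * #|Q|.
  rewrite -[X in X * _](card_ord 4) -cardX; apply: eq_card => p.
  by rewrite !inE.
by rewrite -(card_in_imset inj) max_card.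
Qed.

End Fingerprint.

(** * The streaming machine and the history it abstracts *)

Section Machine.
Variables (n B : nat).
Notation T := 'I_n.
Notation incidence := (incidence n).
Notation entry := (entry n).
Notation item := (item n).
Notation hash := {ffun item -> 'I_4}.
Notation label_matching := (label_matching n).
Notation label_cover := (label_cover n).

Definition word : finType := (entry + incidence)%type.
Definition counter : finType := 'I_B.+1.
(** Last accepted incidence, parity of its layer, the counts of flags, of matching pairs and of the
    cover, then the fingerprints of debit and credit. *)
Definition state : finType :=
  (option incidence * bool * (counter * counter * counter) * (counter * counter))%type.

(* Saturation commutes with addition, so a stored counter is a function of the
   true count; a counter that has reached B is rejected by machine_out. *)
Definition cap (x : nat) : counter := inord (minn x B).

Lemma val_cap x : cap x = minn x B :> nat.
Proof. by rewrite inordK // ltnS geq_minr. Qed.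

Lemma cap_add x y : cap (cap x + y) = cap (x + y).
Proof.
apply: val_inj; rewrite /= !val_cap; apply/eqP.
by rewrite addn_minl -minnA (minn_idPr (leq_addr y B)).
Qed.

(** Lexicographic rank, label first: sorting by it makes the incidences of one label, and the
    repetitions of one incidence, adjacent. *)
Definition key (i : incidence) : nat := i.1 * n + i.2.

Lemma key_inj : injective key.
Proof.
move=> [c u] [d v]; rewrite /key /= => E.
have n0 : 0 < n by apply: leq_ltn_trans (ltn_ord u).
have := congr1 (fun x => x %/ n) E; rewrite !divnMDl // !divn_small // !addn0 => /ord_inj cd.
by move: E; rewrite cd => /addnI/ord_inj->.
Qed.

Lemma key_label i j : key i <= key j -> i.1 <= j.1.
Proof.
case: i j => [c u] [d v]; rewrite /key /= => /(leq_div2r n).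
have n0 : 0 < n by apply: leq_ltn_trans (ltn_ord u).
by rewrite !divnMDl // !divn_small // !addn0.
Qed.

Definition accepts (last : option incidence) (i : incidence) : bool :=
  if last is Some j then key j <= key i else true.

Definition history : Type := (seq entry * seq incidence)%type.

(** The full record of the words read, latest first, serves only the analysis. An incidence out of
    order is ignored, as it is by the machine. *)
Definition history_step (p : history) (x : word) : history :=
  match x with
  | inl x => (x :: p.1, p.2)
  | inr i => if accepts (ohead p.2) i then (p.1, i :: p.2) else p
  end.

Definition machine_start : state := (None, false, (cap 0, cap 0, cap 0), (cap 0, cap 0)).

Definition machine_edge (h : hash) (st : state) (e : edge n) : state :=
  let: (last, par, cnt, (x, y)) := st in (last, par, cnt, (cap (x + h (inl e)), y)).

(* par is the parity of the number of vertices in the layer of the last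
   incidence; a layer gains one half-pair whenever it turns from odd to even. *)
Definition machine_word (h : hash) (st : state) (x : word) : state :=
  let: (last, par, (k, a, b), (x1, x2)) := st in
  match x with
  | inl x => (last, par, (cap (k + x.2), a, b),
      (cap (x1 + fingerprint h (map inr (emit x))), cap (x2 + h (inl x.1.1))))
  | inr i =>
    if ~~ accepts last i then st else
    if last == Some i then (last, par, (k, a, b), (x1, cap (x2 + h (inr i)))) else
    let odd_layer := (if last is Some j then j.1 == i.1 else false) && par in
    (Some i, ~~ odd_layer,
      (k, cap (a + ((i.1 == label_matching) && odd_layer)),
       cap (b + (if i.1 == label_cover then true else (i.1 != label_matching) && odd_layer))),
      (x1, cap (x2 + h (inr i))))
  end.

Definition machine_out (st : state) : option nat :=
  let: (_, _, (k, a, b), (x1, x2)) := st in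
  if [&& k == a, k == b, val k < B, x1 == x2 & val x2 < B] then Some (val k) else None.

Definition abstraction (h : hash) (A : seq (edge n)) (p : history) : state :=
  (ohead p.2, if p.2 is i :: _ then odd #|layer p.2 i.1| else false,
   (cap (count snd p.1), cap (matching_count p.2), cap (cover_count p.2)),
   (cap (fingerprint h (debit A p.1)), cap (fingerprint h (credit p.1 p.2)))).

Definition sorted_history (p : history) := sorted (fun i j => key j <= key i) p.2.

Lemma key_head i L j : sorted (fun i j => key j <= key i) (i :: L) ->
  j \in i :: L -> key j <= key i.
Proof.
have tr : transitive (fun i j => key j <= key i) by move=> y x z yx zy; apply: leq_trans zy yx.
by move=> /(order_path_min tr)/allP H; rewrite inE => /predU1P[->//|/H].
Qed.

Lemma history_step_sorted p x : sorted_history p -> sorted_history (history_step p x).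
Proof.
case: p x => [E L] [x|i] //=; rewrite /sorted_history /=; case: ifP => //=.
by case: L => //= j L ->.
Qed.

Lemma layer_cons (i : incidence) L c :
  layer (i :: L) c = if c == i.1 then i.2 |: layer L c else layer L c.
Proof.
case: i => d u; apply/setP=> v; rewrite inE in_cons xpair_eqE /=.
by case: ifP => cd; rewrite !inE.
Qed.

Lemma card_layer_cons (i : incidence) L c : i \notin L ->
  #|layer (i :: L) c| = #|layer L c| + (c == i.1).
Proof.
move=> iL; rewrite layer_cons; case: eqVneq => [->|]; last by rewrite addn0.
by rewrite cardsU1 inE -surjective_pairing iL addnC.
Qed.

Lemma half_add_bit k (c : bool) : (k + c)./2 = k./2 + (c && odd k).
Proof. by case: c; rewrite ?addn0 //= addn1 -uphalfE uphalf_half addnC. Qed.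

Lemma fingerprint_debit_entry h A (x : entry) E :
  fingerprint h (debit A (x :: E)) =
  fingerprint h (debit A E) + fingerprint h (map inr (emit x)).
Proof.
by rewrite /debit /incidences /= map_cat !fingerprint_cat addnA addnAC.
Qed.

(** By sortedness, an accepted incidence other than the last one is new, and if its label differs
    from the last label, its layer is still empty. Hence the last incidence and one parity bit
    determine every update. *)
Lemma abstraction_step h A p x : sorted_history p ->
  abstraction h A (history_step p x) = machine_word h (abstraction h A p) x.
Proof.
case: p x => [E L] [x|i] srt; rewrite /abstraction /= !cap_add.
  by rewrite fingerprint_debit_entry [count _ _ + _]addnC [fingerprint h (credit _ _) + _]addnC
             {2}/fingerprint /credit /= /fingerprint big_cons.
case: ifP => //= acc.
have credit_cons : fingerprint h (credit E (i :: L)) = fingerprint h (credit E L) + h (inr i).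
  by rewrite /credit !fingerprint_cat /= {2}/fingerprint big_cons addnA addnAC.
rewrite credit_cons; case: eqP => [Ei|nEi].
  case: L Ei srt acc credit_cons => //= j L [->] _ _ _.
  have lay c : layer [:: i, i & L] c = layer (i :: L) c.
    by apply/setP=> v; rewrite !inE orbA orbb.
  by rewrite /matching_count /cover_count !lay; under eq_bigr do rewrite lay.
have iL : i \notin L.
  case: L srt acc nEi {credit_cons} => //= j L srt acc nEi.
  apply/negP=> /(key_head srt) le_ij; apply: nEi; congr Some.
  by apply: key_inj; apply/eqP; rewrite eqn_leq acc le_ij.
have odd_layerE : (if ohead L is Some j then j.1 == i.1 else false) &&
    (if L is j :: _ then odd #|layer L j.1| else false) = odd #|layer L i.1|.
  case: L srt acc {nEi iL credit_cons} => [|j L] srt acc.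
    by rewrite (_ : layer [::] i.1 = set0) ?cards0 //; apply/setP=> v; rewrite !inE.
  have [ji|ji] := eqVneq j.1 i.1; first by rewrite /= ji eqxx.
  rewrite /= (negPf ji); suff -> : layer (j :: L) i.1 = set0 by rewrite cards0.
  apply/setP=> v; rewrite inE [RHS]inE; apply/negP=> /(key_head srt)/key_label /= le_ij.
  by case/negP: ji; rewrite -val_eqE /= eqn_leq le_ij (key_label acc).
rewrite odd_layerE; congr (_, _, (_, cap _, cap _), _).
- by rewrite card_layer_cons // eqxx addn1.
- rewrite /matching_count card_layer_cons // half_add_bit eq_sym.
  by case: eqVneq => // ->.
rewrite /cover_count card_layer_cons // eq_sym.
(* Only the layer of [i.1] changes, and it enters the sum only when [i.1] is neither of the two
   special labels. *)
have sumE : \sum_u #|layer (i :: L) (label_class u)|./2 =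
   \sum_u #|layer L (label_class u)|./2 +
   ((i.1 != label_cover) && (i.1 != label_matching) && odd #|layer L i.1|).
  rewrite (eq_bigr (fun u => #|layer L (label_class u)|./2 +
     ((label_class u == i.1) && odd #|layer L (label_class u)|))); last first.
    by move=> u _; rewrite card_layer_cons // half_add_bit.
  rewrite big_split /=; congr (_ + _).
  case: (splitP (i.1 : 'I_(2 + n))) => [j ij|u iu].
    rewrite big1 => [|u _]; last first.
      by case: eqP => // lu; have := ltn_ord j; rewrite -ij -lu.
    rewrite -!val_eqE /= ij; by case: j {ij} => [[|[]]].
  have -> : i.1 = label_class u by apply: val_inj.
  rewrite (bigD1 u) //= eqxx big1 ?addn0 // => v vu.
  by case: eqP => // /(@rshift_inj 2 n)/eqP; rewrite (negPf vu).
rewrite sumE addnACA; congr (_ + _).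
by case: eqVneq => // _; rewrite add0n.
Qed.

End Machine.

(** * Completeness and soundness of the machine on whole streams *)

Section Run.
Variables (n m : nat).
(** A balanced certificate has at most m + 4 m items, each with hash value at most 3; the extra 1
    tells exact counters from saturated ones. *)
Notation B := (15 * m + 1).
Notation entry := (entry n).
Notation incidence := (incidence n).
Notation hash := {ffun item n -> 'I_4}.

Definition history_of (ws : seq (word n)) : history n := foldl (@history_step n) ([::], [::]) ws.

Definition machine_run (h : hash) (A : seq (edge n)) (ws : seq (word n)) : state n B :=
  foldl (machine_word h) (foldl (machine_edge h) (machine_start n B) A) ws.

Lemma machine_runE h A ws : machine_run h A ws = abstraction B h A (history_of ws).
Proof.
have startE : foldl (machine_edge h) (machine_start n B) A = abstraction B h A ([::], [::]).
  have lay c : layer (Nil incidence) c = set0 by apply/setP=> v; rewrite !inE.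
  elim/last_ind: A => [|A e IH]; last first.
    rewrite foldl_rcons IH /= /abstraction /= cap_add; congr (_, _, (_, _)); congr cap.
    by rewrite /debit /= !cats0 map_rcons -cats1 fingerprint_cat /fingerprint big_seq1.
  rewrite /abstraction /= /matching_count /cover_count !lay cards0 /fingerprint !big_nil.
  by rewrite big1 // => u _; rewrite lay cards0.
rewrite /machine_run startE /history_of.
suff [-> //] : foldl (machine_word h) (abstraction B h A ([::], [::])) ws =
    abstraction B h A (foldl (@history_step n) ([::], [::]) ws) /\
    sorted_history (foldl (@history_step n) ([::], [::]) ws).
elim/last_ind: ws => [|ws x [IH srt]] //; rewrite !foldl_rcons IH -abstraction_step //.
by split=> //; apply: history_step_sorted.
Qed.

(** This condition does not mention the hash function, so a word sequence either always convinces
    or, when it fails, convinces only through collisions. *)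
Definition valid_words (A : stream n m) (ws : seq (word n)) : bool :=
  let p := history_of ws in
  [&& perm_eq (debit A p.1) (credit p.1 p.2),
      count snd p.1 == matching_count p.2 & count snd p.1 == cover_count p.2].

Lemma cap_eq x y : x < B -> (cap B x == cap B y) = (x == y).
Proof.
move=> xB; rewrite -val_eqE /= !val_cap (minn_idPl (ltnW xB)).
case: (leqP y B) => // By.
by rewrite (ltn_eqF xB) (ltn_eqF (ltn_trans xB By)).
Qed.

Lemma cap_small x : x < B -> cap B x = x :> nat.
Proof. by move=> xB; rewrite val_cap (minn_idPl (ltnW xB)). Qed.

Section Balanced.
Variables (A : stream n m) (E : seq entry) (L : seq incidence).
Hypothesis bal : perm_eq (debit A E) (credit E L).

Lemma count_lt_cap : count snd E < B.
Proof.
have [<- _] := size_balance bal; rewrite addn1 ltnS.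
by apply: leq_trans (count_size _ _) _; rewrite leq_pmull.
Qed.

Lemma fingerprint_lt_cap h : fingerprint h (credit E L) < B.
Proof.
rewrite addn1 ltnS; apply: leq_trans (fingerprint_le _ _) _.
have [sE sL] := size_balance bal.
rewrite /credit size_cat !size_map sE -[15]/(3 * 5) -mulnA leq_mul2l /=.
by rewrite mulSn leq_add2l.
Qed.

End Balanced.

Lemma valid_run (A : stream n m) ws h : valid_words A ws ->
  machine_out (machine_run h A ws) = Some (max_matching_size A).
Proof.
rewrite machine_runE /valid_words /abstraction; case: (history_of ws) => E L /=.
move=> /and3P[bal /eqP eqM /eqP eqC].
have kB := count_lt_cap bal; have fB := fingerprint_lt_cap bal h.
rewrite (fingerprint_perm h bal) -eqM -eqC !eqxx !cap_small // kB fB /=.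
by congr Some; apply: certificate_sound bal eqM eqC.
Qed.

Lemma invalid_run (A : stream n m) ws : ~~ valid_words A ws ->
  3 * #|[pred h : hash | machine_out (machine_run h A ws) != None]| <= #|{: hash}|.
Proof.
move=> inv; have out_h h : machine_out (machine_run h A ws) != None ->
    fingerprint h (debit A (history_of ws).1) ==
    fingerprint h (credit (history_of ws).1 (history_of ws).2) /\
    ~~ perm_eq (debit A (history_of ws).1) (credit (history_of ws).1 (history_of ws).2).
  rewrite machine_runE /abstraction; move: inv; rewrite /valid_words.
  case: (history_of ws) => E L /= inv; case: ifP => // /and5P[ka kb kB xx xB] _.
  move: xx xB; rewrite eq_sym -val_eqE /= !val_cap => xx xB.
  (* The credit side is not saturated, so equal capped values mean equal fingerprints. *)
  have xB' : fingerprint h (credit E L) < B by move: xB; rewrite gtn_min ltnn orbF.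
  split; first by move: xx; rewrite -!val_cap val_eqE cap_eq // eq_sym.
  apply: contra inv => bal; rewrite bal /=.
  by move: ka kb; rewrite !cap_eq ?(count_lt_cap bal) // => -> ->.
have [bal|nbal] := boolP (perm_eq (debit A (history_of ws).1)
  (credit (history_of ws).1 (history_of ws).2)).
  rewrite eq_card0 ?muln0 // => h; rewrite !inE; apply/negP=> Hh.
  by have [_] := out_h h (introN idP Hh); rewrite bal.
apply: leq_trans (card_collision nbal).
apply: (@leq_trans (3 * #|[pred h : hash | fingerprint h (debit A (history_of ws).1) ==
    fingerprint h (credit (history_of ws).1 (history_of ws).2)]|)); last by rewrite leq_mul2r orbT.
rewrite leq_mul2l /=; apply: subset_leq_card; apply/subsetP=> h; rewrite !inE.
by move=> Hh; have [] := out_h h Hh.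
Qed.

Lemma foldl_history_entries E0 L0 s :
  foldl (@history_step n) (E0, L0) (map inl s) = (catrev s E0, L0).
Proof. by elim: s E0 => //= x s IH E0; rewrite IH. Qed.

Lemma foldl_history_incidences E0 L0 s :
  (if L0 is j :: _ then path (relpre (@key n) leq) j s else sorted (relpre (@key n) leq) s) ->
  foldl (@history_step n) (E0, L0) (map inr s) = (E0, catrev s L0).
Proof.
elim: s L0 => //= i s IH L0 srt.
have [acc srt'] : accepts (ohead L0) i /\ path (relpre (@key n) leq) i s.
  by case: L0 srt => //= j L0 /andP[].
by rewrite acc IH.
Qed.

Lemma layer_eq_mem (L L' : seq incidence) : L =i L' ->
  matching_count L = matching_count L' /\ cover_count L = cover_count L'.
Proof.
move=> eqL; have lay c : layer L c = layer L' c by apply/setP=> v; rewrite !inE eqL.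
by rewrite /matching_count /cover_count !lay; split=> //; under eq_bigr do rewrite lay.
Qed.

Lemma valid_words_exist (A : stream n m) :
  exists ws, valid_words A ws && (size ws <= 5 * m).
Proof.
have [E [permE eqK eqM eqC]] := certificate_exists A.
pose L := sort (relpre (@key n) leq) (incidences E).
have memL : rev L =i incidences E by move=> i; rewrite mem_rev mem_sort.
have [eqM' eqC'] := layer_eq_mem memL.
have bal : perm_eq (debit A E) (credit E (rev L)).
  apply: perm_cat; first exact: perm_map.
  by apply: perm_map; rewrite perm_sym perm_rev perm_sort.
(* Entries are sent in reverse because the history lists the latest word first. *)
pose ws : seq (word n) := map inl (rev E) ++ map inr L.
have hist : history_of ws = (E, rev L).
  rewrite /history_of foldl_cat foldl_history_entries foldl_history_incidences.
    by rewrite !catrevE revK !cats0.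
  by apply: sort_sorted => i j; apply: leq_total.
exists ws; rewrite /valid_words hist /= bal eqM' eqC' eqK eqM eqC !eqxx /=.
have [sE sL] := size_balance bal.
by rewrite size_cat !size_map size_rev sE mulSn leq_add2l -(size_rev L).
Qed.

Definition honest_words (A : stream n m) : seq (word n) := xchoose (valid_words_exist A).

Lemma honest_wordsP A : valid_words A (honest_words A) /\ size (honest_words A) <= 5 * m.
Proof. by apply/andP; apply: (xchooseP (valid_words_exist A)). Qed.

End Run.

(** * Bit lengths of words and states, and the resulting protocol *)

Section Costs.
Variables (n m : nat).

(** With N = 2^[bit_length n], there are at most 4 N^3 entries and at most 4 N^3 incidences. *)
Definition word_bits := 3 * bit_length n + 3.
(** In order: the last incidence with its parity, five counters up to 15 m + 1, and the buffer for a
    partial word. *)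
Definition state_bits :=
  (2 * bit_length n + 3) + ((bit_length m + 4) * 3 + (bit_length m + 4) * 2) + word_bits.+1.
Definition hash_bits := 2 * #|item n|.

Lemma ltn_bit_length k : k < 2 ^ bit_length k.
Proof. exact: trunc_log_ltn. Qed.

Lemma bit_length_gt1 k : 2 <= 2 ^ bit_length k.
Proof. by rewrite -[leqLHS]expn1 leq_exp2l. Qed.

Lemma card_edge : #|{: edge n}| <= n ^ 2.
Proof.
rewrite card_sig -(eq_card (A := [set A : {set 'I_n} | #|A| == 2])) => [|A]; last by rewrite !inE.
rewrite card_draws card_ord bin2 -mulnn.
by rewrite -divn2; apply: leq_trans (leq_div _ _) _; rewrite leq_mul2l leq_pred orbT.
Qed.

Lemma card_hash : #|{: hash_bits.-tuple bool}| = #|{ffun item n -> 'I_4}|.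
Proof. by rewrite card_tuple card_bool card_ffun card_ord /hash_bits expnM. Qed.

Lemma card_incidence : #|incidence n| <= 2 * (2 ^ bit_length n) ^ 2.
Proof.
rewrite card_prod !card_ord; set N := 2 ^ _.
have nN : n < N := ltn_bit_length n; have N2 : 2 <= N := bit_length_gt1 n.
rewrite -mulnn mulnA; apply: leq_mul; last exact: ltnW.
by rewrite mul2n -addnn -addn2 leq_add // ltnW.
Qed.

Lemma card_word : #|word n| <= #|{: word_bits.-tuple bool}|.
Proof.
rewrite card_sum card_tuple card_bool /word_bits.
have -> : 2 ^ (3 * bit_length n + 3) = 4 * (2 ^ bit_length n) ^ 3 + 4 * (2 ^ bit_length n) ^ 3.
  by rewrite -mulnDl expnD mulnC mulnC [3 * _]mulnC expnM mulnC.
apply: leq_add; last first.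
  apply: leq_trans card_incidence _; apply: leq_mul => //.
  by rewrite leq_pexp2l ?expn_gt0.
rewrite !card_prod card_bool card_ord mulnC mulnA mulnC.
have -> : (2 ^ bit_length n) ^ 3 = (2 ^ bit_length n) ^ 2 * 2 ^ bit_length n by rewrite -expnSr.
have nN := ltnW (ltn_bit_length n).
have : #|{: edge n}| <= (2 ^ bit_length n) ^ 2 by apply: leq_trans card_edge (leq_expl _ nN).
move: nN; set N := 2 ^ _; move: #|{: edge n}| => e nN eN.
by rewrite mulnACA [n * e]mulnC; apply: leq_mul => //; apply: leq_mul.
Qed.

Lemma card_state :
  #|{: state n (15 * m + 1) * word_bits.-bseq bool}| <= #|{: state_bits.-tuple bool}|.
Proof.
rewrite card_tuple card_bool card_prod /state_bits.
rewrite expnD; apply: leq_mul; last exact/ltnW/card_bseq_bool.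
have cC : (15 * m + 1).+1 <= 2 ^ (bit_length m + 4).
  rewrite expnD; apply: leq_trans (leq_mul (ltn_bit_length m) (leqnn _)).
  by rewrite [leqRHS]mulnC mulnS -addnS [leqLHS]addnC; apply: leq_add => //; apply: leq_mul.
rewrite expnD [2 ^ (_ * 3 + _)]expnD ![2 ^ (_ * _)]expnM.
rewrite !card_prod card_option card_bool !card_ord.
rewrite -mulnA; apply: leq_mul; last first.
  by apply: leq_mul; rewrite mulnn -?expnSr leq_expl.
rewrite expnD [2 * _]mulnC expnM -[2 ^ 3]/(4 * 2) mulnA leq_mul2r /=.
apply: leq_ltn_trans card_incidence _.
have : 0 < (2 ^ bit_length n) ^ 2 by rewrite !expn_gt0.
by move: (_ ^ 2) => k k0; rewrite mulnC ltn_mul2l k0.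
Qed.

Definition matching_verifier : verifier n :=
  compile card_hash card_state card_word (machine_start n (15 * m + 1))
    (@machine_edge n (15 * m + 1)) (@machine_word n (15 * m + 1)) (@machine_out n (15 * m + 1)).

Definition matching_helper : helper n m := fun A => encode card_word (honest_words A).

Definition matching_protocol : protocol n m := Protocol matching_verifier matching_helper.

Lemma matching_protocol_valid : valid_protocol (@max_matching_size n m) matching_protocol.
Proof.
have w0 : 0 < word_bits by rewrite addn_gt0 orbT.
split=> [A|H A]; rewrite /valid_annotation.
  apply/prob_eq1; apply/(compile_always card_hash w0) => o; rewrite encodeK //.
  by apply: valid_run; have [] := honest_wordsP A.
have [val|inval] := boolP (valid_words A (decode card_word (H A))).
  by left; apply/prob_eq1; apply/(compile_always card_hash w0) => o; apply: valid_run.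
right; rewrite prob_le3 (compile_card card_hash w0 _ _ _ _ _ _ _ _ (fun y => y != None)).
by rewrite [leqRHS]card_hash; apply: invalid_run inval.
Qed.

Lemma help_cost_matching : help_cost matching_protocol <= 5 * m * word_bits.
Proof.
apply/bigmax_leqP=> A _; rewrite /= size_encode.
by have [_ le_ws] := honest_wordsP A; rewrite leq_mul2r le_ws orbT.
Qed.

End Costs.

Lemma matching_hv_protocol :
  hv_protocol (@max_matching_size) (fun n m : nat => m) (fun n m : nat => 1) matching_protocol.
Proof.
split=> [n m|K]; first exact: matching_protocol_valid.
(* The help cost needs the factor 15 K + 15, and the state takes at most 5 K + 32 times
   [bit_length m] bits. *)
exists (15 * K + 32) => n m le_K.
have l0 : 0 < bit_length m by [].
have le_w : word_bits n <= (3 * K + 3) * bit_length m.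
  rewrite /word_bits mulnDl -mulnA leq_add ?leq_mul2l ?le_K //.
  by rewrite -[leqLHS]muln1 leq_mul2l.
split.
  apply: leq_trans (help_cost_matching n m) _.
  apply: leq_trans (leq_mul (leqnn _) le_w) _; rewrite mulnACA; apply: leq_mul; last first.
    by rewrite leq_mul2r leqnSn orbT.
  by rewrite mulnDr mulnA; apply: leq_add.
rewrite /verification_cost /= /state_bits; move: le_K le_w l0.
move: (bit_length n) (bit_length m) (word_bits n) => a b w le_K le_w l0.
nia.
Qed.

Theorem theorem2 :
  (exists P : forall n m : nat, protocol n m,
     hv_protocol (@max_matching_size) (fun n m : nat => m) (fun n m : nat => 1) P)
  /\
  (forall D : nat, exists c n0 : nat, forall n m : nat,
     n0 <= n -> n ^ 2 <= D * m ->
     forall P : protocol n m, valid_protocol (@max_matching_size n m) P ->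
     n ^ 2 <= c * (maxn 1 (help_cost P) * verification_cost P)).
Proof.
split; first by exists matching_protocol; exact: matching_hv_protocol.
(* Passing from [D] to [D.+1] keeps the divisor that defines the gadget's side positive. *)
move=> D; exists ((64 * D.+1) ^ 2 * 10), (32 * D.+1) => n m le_n le_m P.
apply: help_verification_tradeoff le_n _.
by apply: leq_trans le_m _; rewrite leq_mul2r leqnSn orbT.
Qed.
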